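(* Let $X$ and $Y$ be real-valued random variables with finite variance. If $\mathbb{E}[X] = \mathbb{E}[Y]$ and $\mathrm{Var}[X] < \mathrm{Var}[Y]$, then there exists a random variable $Z$ that is independent from $X$ and $Y$ and such that $$X + Z >_{2} Y + Z.$$ In particular, $X + Z' >_{2} Y + Z'$ for every $Z'$ that is independent of $X$ and $Y$ and noisier than $Z$. Additionally, if $X, Y \in \mathcal{P}_\infty$, then $Z$ can be taken to belong to $\mathcal{P}_\infty$.
   Context: For real random variables $X,Y$, write $X \geq_2 Y$ ($X$ second-order stochastically dominates $Y$) if $\mathbb{E}[\phi(X)] \geq \mathbb{E}[\phi(Y)]$ for every concave increasing (i.e. non-decreasing) function $\phi:\mathbb{R}\to\mathbb{R}$ for which the two expectations are well defined. Write $X >_2 Y$ if $X \geq_2 Y$ and $X$ and $Y$ have distinct distributions. $\mathcal{P}_\infty$ is the set of random variables $X$ with all finite moments: $\mathbb{E}[|X|^n]<\infty$ for all $n\in\mathbb{N}$. $Z'$ is noisier than $Z$ if $Z' = Z + W$ for some random variable $W$ independent of $Z$. Stochastic dominance depends only on distributions. The underlying probability space may be enlarged, if necessary, to carry an independent random variable of a prescribed distribution. *)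

(* Defs.v *)
From HB Require Import structures.
From mathcomp Require Import all_boot all_order all_algebra.
From mathcomp Require Import all_classical all_reals all_analysis.

Set Implicit Arguments.
Unset Strict Implicit.
Unset Printing Implicit Defensive.

Import Order.TTheory GRing.Theory Num.Theory.
Import numFieldNormedType.Exports.

Local Open Scope classical_set_scope.
Local Open Scope ring_scope.

(* Values of a measure on non-measurable sets are unconstrained in the library,
   so equality of laws is only required on measurable sets. *)
Definition same_law d d' (T : measurableType d) (T' : measurableType d')
    (R : realType) (P : probability T R) (X Y : T -> T') : Prop :=
  forall A : set T', measurable A -> P (X @^-1` A) = P (Y @^-1` A).

Definition independent d d1 d2 (T : measurableType d) (T1 : measurableType d1)
    (T2 : measurableType d2) (R : realType) (P : probability T R)
    (X : T -> T1) (Y : T -> T2) : Prop :=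
  forall (A : set T1) (B : set T2), measurable A -> measurable B ->
    P (X @^-1` A `&` Y @^-1` B) = (P (X @^-1` A) * P (Y @^-1` B))%E.

(* The library's expectation is total, with a junk value in the case oo - oo,
   which is excluded here; an infinite expectation counts as well defined. *)
Definition expectation_defined d (T : measurableType d) (R : realType)
    (P : probability T R) (X : T -> R) : Prop :=
  ('E_P[X^\+] < +oo)%E \/ ('E_P[X^\-] < +oo)%E.

Definition concave_function (R : realType) (phi : R -> R) : Prop :=
  @convex_function R R^o [set: R] (fun x => - phi x).

Definition ssd_ge d (T : measurableType d) (R : realType)
    (P : probability T R) (X Y : T -> R) : Prop :=
  forall phi : R -> R, concave_function phi -> nondecreasing_fun phi ->
    expectation_defined P (phi \o X) -> expectation_defined P (phi \o Y) ->
    ('E_P[phi \o Y] <= 'E_P[phi \o X])%E.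

Definition ssd_gt d (T : measurableType d) (R : realType)
    (P : probability T R) (X Y : T -> R) : Prop :=
  ssd_ge P X Y /\ ~ same_law P X Y.

Definition finite_moments d (T : measurableType d) (R : realType)
    (P : probability T R) (X : T -> R) : Prop :=
  forall n : nat, ('E_P[(fun w => `|X w| ^+ n)%R] < +oo)%E.

Definition noisier d (T : measurableType d) (R : realType)
    (P : probability T R) (Z' Z : T -> R) : Prop :=
  exists W : {RV P >-> R}, independent P W Z /\ Z' = Z \+ W.

(* (T', P') enlarges (T, P) along p : a random variable X on T is identified
   with X \o p on T'. *)
Definition enlargement d d' (T : measurableType d) (T' : measurableType d')
    (R : realType) (P : probability T R) (P' : probability T' R)
    (p : {mfun T' >-> T}) : Prop :=
  forall A : set T, measurable A -> P' (p @^-1` A) = P A.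

(* Main.v *)
(* [U >=_2 V] follows from [E g(U) <= E g(V)] for all nonnegative nonincreasing
   convex losses [g] (applied to [n - min phi n], then [n -> oo]), and if a law
   of noise [nu] achieves this for [X] and [Y], so does [nu] convolved with any
   other law, by Tonelli.

   When [X] and [Y] have all moments, [nu] is the law of [Z1 + U1 + U2] with
   [U1], [U2] uniform on [0, 1] and [Z1] of density proportional to [1 / w],
   [w x = prod_i (1 + c_i |x|)].  The [c_i > 0] are so small that
   [E (X^2 w(X)) + E (Y^2 w(Y)) <= 2 E Y^2]; [w] is submultiplicative and grows
   faster than any polynomial.  For convex [g] put [G x = E g(x + Z1)] and
   [Phi x = E G(x + U1 + U2)].  Then [Phi'' = K] is a second difference of [G],
   and [1 / w(y) <= K y / K 0 <= w y] by submultiplicativity; hence [Phi y] lies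
   between [Phi 0 + Phi'(0) y + K 0 y^2 / (2 w y)] and
   [Phi 0 + Phi'(0) y + K 0 y^2 w(y) / 2], and taking expectations gives
   [E Phi(X) <= E Phi(Y)].

   When some moment of [X] or [Y] is infinite, nothing is required of the
   moments of [Z], and a noise with [E Z^- = oo] makes the expectation of every
   nonconstant loss infinite on the side of [Y].

   The laws of [X + Z'] and [Y + Z'] differ because equality would force the
   characteristic functions of [X] and [Y] to agree near [0], hence the second
   moments to coincide. *)

Require Import Defs.
From HB Require Import structures.
From mathcomp Require Import all_boot all_order all_algebra.
From mathcomp Require Import all_classical all_reals all_analysis.
From mathcomp Require Import measurable_realfun ring lra.

Set Implicit Arguments.
Unset Strict Implicit.
Unset Printing Implicit Defensive.

Import Order.TTheory GRing.Theory Num.Theory.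
Import numFieldNormedType.Exports.

Local Open Scope classical_set_scope.
Local Open Scope ring_scope.

(** * Independence *)

Lemma bounded_prob_integrable d (T : measurableType d) (R : realType)
    (P : probability T R) (h : T -> R) (C : R) :
  measurable_fun setT h -> (forall x, `|h x| <= C) ->
  P.-integrable setT (EFin \o h).
Proof.
move=> mh hC; apply: measurable_bounded_integrable => //.
  by rewrite (le_lt_trans (probability_le1 _ _)) ?ltry.
exists C; split; first exact: num_real.
by move=> y Cy x _; exact: le_trans (hC x) (ltW Cy).
Qed.

Lemma integral_prob_cst d (T : measurableType d) (R : realType)
  (P : probability T R) (c : \bar R) : (\int[P]_x cst c x = c)%E.
Proof. by rewrite integral_cst//= probability_setT mule1. Qed.

(** Given a name so that a measurable-function structure can be attached to it; the joint law is
    then a [distribution]. *)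
Definition mfun_pair d (T : measurableType d) d1 (T1 : measurableType d1)
  d2 (T2 : measurableType d2) (V : {mfun T >-> T1}) (U : {mfun T >-> T2}) :=
  fun w => (V w, U w).

Section mfun_pair.
Context d (T : measurableType d) d1 (T1 : measurableType d1)
  d2 (T2 : measurableType d2) (V : {mfun T >-> T1}) (U : {mfun T >-> T2}).

Let mfun_pair_measurable : measurable_fun setT (mfun_pair V U).
Proof. exact/measurable_fun_pair. Qed.

HB.instance Definition _ :=
  isMeasurableFun.Build _ _ _ _ (mfun_pair V U) mfun_pair_measurable.

End mfun_pair.

Section independence.
Context d (T : measurableType d) d1 (T1 : measurableType d1)
  d2 (T2 : measurableType d2) (R : realType) (P : probability T R)
  (V : {mfun T >-> T1}) (U : {mfun T >-> T2}).
Hypothesis VU : independent P V U.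
Local Open Scope ereal_scope.

(** Independence is agreement of the two measures on rectangles, and a product measure is determined
    by its values there. *)
Lemma joint_distributionE (A : set (T1 * T2)) : measurable A ->
  (distribution P V \x distribution P U) A =
  distribution P (mfun_pair V U) A.
Proof.
move: A; have := @product_measure_unique _ _ _ _ _ (distribution P V)
  (distribution P U)
  (distribution P (mfun_pair V U)); apply => B C mB mC.
by rewrite /distribution /pushforward -VU.
Qed.

(** Change of variables to the joint law, which is a product law by independence, then Tonelli. *)
Lemma ge0_integral_independent (F : T1 * T2 -> \bar R) :
  measurable_fun setT F -> (forall z, 0 <= F z) ->
  \int[P]_w F (V w, U w) =
  \int[distribution P V]_v \int[distribution P U]_u F (v, u).
Proof.
move=> mF F0.
rewrite -(fubini_tonelli1 (m1 := distribution P V) (m2 := distribution P U))//.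
rewrite [RHS](eq_measure_integral (distribution P (mfun_pair V U))).
  by rewrite ge0_integral_pushforward.
by move=> A mA _; exact: joint_distributionE.
Qed.

(** The bounded signed case, meant for sines and cosines: boundedness supplies the integrability
    that Fubini requires. *)
Lemma integral_independentM (f : T1 -> R) (g : T2 -> R) (M : R) :
  measurable_fun setT f -> measurable_fun setT g ->
  (forall x, `|f x| <= M)%R -> (forall x, `|g x| <= M)%R ->
  \int[P]_w (f (V w) * g (U w))%:E =
  \int[P]_w (f (V w))%:E * \int[P]_w (g (U w))%:E.
Proof.
move=> mf mg bf bg; have intb d' (T' : measurableType d') (Q : probability T'
  R) (h : T' -> R) (C : R) :=
  @bounded_prob_integrable d' T' R Q h C.
pose F := fun z : T1 * T2 => (f z.1 * g z.2)%:E.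
have M0 : (0 <= M)%R by apply: le_trans (bf (V point)).
have mF : measurable_fun setT F.
  apply/measurable_EFinP/measurable_funM; exact/measurableT_comp.
have bF z : `|F z| <= (M * M)%:E.
  by rewrite /F abse_EFin lee_fin normrM ler_pM.
have iF : P.-integrable setT (F \o mfun_pair V U).
  apply: (intb _ _ P (fun w => f (V w) * g (U w))%R (M * M)%R).
    by apply: measurable_funM; exact: measurableT_comp.
  by move=> w; rewrite normrM ler_pM.
have iF2 : (distribution P V \x distribution P U).-integrable setT F.
  apply/integrable12ltyP => //.
  rewrite (@le_lt_trans _ _ (\int[distribution P V]_x \int[distribution P U]_y
    (cst (M * M)%:E) y))//.
    apply: ge0_le_integral => //.
    - by move=> x _; exact: integral_ge0.
    - apply: (measurable_fun_fubini_tonelli_F (abse \o F)).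
        exact: measurableT_comp.
      by move=> z; exact: abse_ge0.
    - by move=> x _; apply: ge0_le_integral => //;
        exact/measurableT_comp/measurableT_comp.
  rewrite (eq_integral (cst (M * M)%:E)) => [|x _]; last
    exact: integral_prob_cst.
  by rewrite integral_prob_cst ltry.
transitivity (\int[distribution P (mfun_pair V U)]_z F z).
  by rewrite integral_pushforward.
rewrite (eq_measure_integral (distribution P V \x distribution P U)%E);
  last first.
  by move=> A mA _; exact/esym/joint_distributionE.
rewrite -integral12_prod_meas1//.
transitivity (\int[distribution P V]_v ((f v)%:E * \int[P]_w (g (U w))%:E)).
  apply: eq_integral => v _; rewrite /fubini_F /F /=.
  under eq_integral do rewrite EFinM.
  rewrite integralZl//; last exact: (intb _ _ _ g M).
  rewrite integral_pushforward//; first exact/measurable_EFinP.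
  by apply: (intb _ _ _ (g \o U) M) => [|w /=];
    [exact: measurableT_comp|exact: bg].
have igU : \int[P]_w (g (U w))%:E \is a fin_num.
  apply: integrable_fin_num => //; apply: (intb _ _ _ (g \o U) M) => [|w /=];
    last exact: bg.
  exact: measurableT_comp.
rewrite -(fineK igU) integralZr//; last exact: (intb _ _ _ f M).
congr (_ * _); rewrite integral_pushforward//; first exact/measurable_EFinP.
by apply: (intb _ _ _ (f \o V) M) => [|w /=];
  [exact: measurableT_comp|exact: bf].
Qed.
End independence.

(** * Taylor bounds and smoothing by uniform noise *)

Section calculus.
Context (R : realType).
Implicit Types (f F G p q : R -> R) (a b x y M m : R).
Local Notation mu := (@lebesgue_measure R).

Lemma is_derive_continuous f (df : R) x : is_derive x 1 f df ->
  {for x, continuous f}.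
Proof. by move=> [dfx _]; exact/differentiable_continuous/derivable1_diffP. Qed.

Lemma continuous_segment_integrable f a b : continuous f ->
  mu.-integrable `[a, b] (EFin \o f).
Proof.
move=> cf; apply: continuous_compact_integrable; first exact: segment_compact.
exact: continuous_subspaceT.
Qed.

Lemma continuous_antiderivative f : continuous f ->
  exists F, forall x, is_derive x 1 F (f x).
Proof.
move=> cf; pose I a b := (\int[mu]_(t in `[a, b]) f t)%R.
have fi a b : mu.-integrable `[a, b] (EFin \o f) by
  exact: continuous_segment_integrable.
have IB a b c : a <= b -> b <= c -> I a c - I a b = I b c.
  move=> ab bc; rewrite /I Rintegral_itvB ?bnd_simp//.
  rewrite Rintegral_itv_obnd_cbnd//.
  by apply: integrableS (fi b c) => //; exact: subset_itv_oc_cc.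
have I0 a b : b <= a -> I a b = 0.
  rewrite /I le_eqVlt => /predU1P[->|ba]; first
    by rewrite set_itv1 Rintegral_set1.
  by rewrite set_itv_ge ?Rintegral_set0// bnd_simp -ltNge.
(* For each sign of [x] one of the two integrals vanishes, so the difference is the oriented
   integral from 0 to [x]. *)
exists (fun x => I 0 x - I x 0) => x.
(* A base point left of both [x] and 0: near [x] the candidate primitive is [I l] minus a constant,
   to which the fundamental theorem applies. *)
pose l := Num.min x 0 - 1.
have lx : l < x by rewrite /l ltrBlDr (le_lt_trans (_ : _ <= x))
  ?ltrDl// ge_min lexx.
have l0 : l <= 0 by rewrite /l lerBlDr (le_trans (_ : _ <= 0))
  ?add0r// ge_min lexx orbT.
have xx1 : x < x + 1 by rewrite ltrDl.
have [dI IE] := @continuous_FTC1_closed R f l x (x + 1) xx1 (fi _ _) lx (cf x).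
apply: (@near_eq_is_derive _ _ _ (fun t => I l t - I l 0)).
  near=> t.
  have lt : l <= t by rewrite ltW//; near: t; exact: lt_nbhsr.
  have [t0|t0] := leP 0 t.
    by rewrite (I0 t 0)// subr0 IB.
  by rewrite (I0 0 t) ?sub0r ?(ltW t0)// -(IB l t 0)// ?(ltW t0)// opprB.
have -> : f x = f x - 0 by rewrite subr0.
apply: (@is_deriveB _ _ _ (I l) (cst (I l 0))).
by split; [exact: dI|exact: etrans (esym (derive1E _ _)) IE].
Unshelve. all: by end_near. Qed.

Lemma integral_uniform01_derive f F y :
  (forall x, is_derive x 1 F (f x)) -> continuous f -> (forall x, 0 <= f x) ->
  (\int[uniform_prob (@ltr01 R)]_u (f (y + u))%:E = (F (y + 1) - F y)%:E)%E.
Proof.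
move=> dF cf f0.
have csh : continuous (fun u => y + u).
  by move=> u; apply: cvgD; [exact: cvg_cst|exact: cvg_id].
have cfy : continuous (fun u => f (y + u)).
  by move=> u; apply: (@continuous_comp _ _ _ (fun u => y + u) f);
    [exact: csh|exact: cf].
have dFy (u : R) : is_derive u 1 (fun u => F (y + u)) (f (y + u)).
  have -> : f (y + u) = f (y + u) * (0 + 1) by rewrite add0r mulr1.
  by apply: (@is_derive1_comp _ F (fun u => y + u)).
have mf : measurable_fun setT (fun u => (f (y + u))%:E).
  by apply/measurable_EFinP; apply: continuous_measurable_fun.
rewrite integral_uniform//; last by move=> u; rewrite lee_fin.
rewrite subr0 invr1 mul1e (@continuous_FTC2 _ _ (fun u => F (y + u)))//.
- by rewrite addr0 EFinB.
- exact: continuous_subspaceT.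
- split.
  + by move=> u _; case: (dFy u).
  + by apply: cvg_at_right_filter; exact: (is_derive_continuous (dFy 0)).
  + by apply: cvg_at_left_filter; exact: (is_derive_continuous (dFy 1)).
- by move=> u _; rewrite derive1E; case: (dFy u).
Qed.

(** Mean value theorem based at 0, for either sign of [y]. The condition [0 <= t * y] keeps [t] on
    the side of [y], so that two applications can be chained. *)
Lemma mvt0 f f' y : (forall x, is_derive x 1 f (f' x)) -> f 0 = 0 ->
  exists2 t, `|t| <= `|y| /\ 0 <= t * y & f y = f' t * y.
Proof.
move=> df f0.
have cf a b : {within `[a, b], continuous f}.
  by apply: continuous_subspaceT => x; exact: is_derive_continuous (df x).
have [y0|y0] := leP 0 y.
  have [t + E] := @MVT_segment _ f f' 0 y y0 (fun x _ => df x) (cf _ _).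
  rewrite in_itv/= => /andP[t0 ty].
  exists t; last by rewrite -[LHS]subr0 -f0 E subr0.
  rewrite !ger0_norm//; split=> //; exact: mulr_ge0.
have [t + E] := @MVT_segment _ f f' y 0 (ltW y0) (fun x _ => df x) (cf _ _).
rewrite in_itv/= => /andP[ty t0].
exists t; last by apply: oppr_inj;
  rewrite -mulrN -[in RHS](sub0r y) -E f0 sub0r.
rewrite !ler0_norm ?(ltW y0)//; split; first by rewrite lerN2.
by rewrite mulr_le0// ltW.
Qed.

(** Subtracting the quadratic polynomial leaves [q] with [q 0 = q' 0 = 0]; two uses of [mvt0] give
    [q y = (p'' s - M) * (t * y)], which is nonpositive. *)
Lemma taylor2_le p p' p'' M y : (forall x, is_derive x 1 p (p' x)) ->
  (forall x, is_derive x 1 p' (p'' x)) ->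
  (forall x, `|x| <= `|y| -> p'' x <= M) ->
  p y <= p 0 + p' 0 * y + M / 2 * y ^+ 2.
Proof.
move=> dp dp' p''M.
pose q x := p x - p 0 - p' 0 * x - M / 2 * (x * x).
pose q' x := p' x - p' 0 - M * x.
have dq x : is_derive x 1 q (q' x).
  have := dp x => dpx; rewrite /q; apply: is_derive_eq.
  by rewrite /GRing.scale/= /q'; field.
have dq' x : is_derive x 1 q' (p'' x - M).
  have := dp' x => dpx; rewrite /q'; apply: is_derive_eq.
  by rewrite /GRing.scale/=; field.
have [|t [ty t0] qy] := mvt0 y dq; first by rewrite /q; ring.
have [|s [st s0] q't] := mvt0 t dq'; first by rewrite /q'; ring.
have : q y <= 0.
  rewrite qy q't -mulrA mulr_le0_ge0// subr_le0 p''M//.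
  exact: le_trans st ty.
by rewrite /q; lra.
Qed.

Lemma taylor2_ge p p' p'' m y : (forall x, is_derive x 1 p (p' x)) ->
  (forall x, is_derive x 1 p' (p'' x)) ->
  (forall x, `|x| <= `|y| -> m <= p'' x) ->
  p 0 + p' 0 * y + m / 2 * y ^+ 2 <= p y.
Proof.
move=> dp dp' mp''.
have := @taylor2_le (fun x => - p x) (fun x => - p' x) (fun x => - p'' x) (- m)
  y.
move=> /(_ (fun x => is_deriveN (dp x)) (fun x => is_deriveN (dp' x))).
have N x : `|x| <= `|y| -> - p'' x <= - m by rewrite lerN2; exact: mp''.
by move=> /(_ N); lra.
Qed.

End calculus.

(** Averaging over a uniform shift is a unit difference of a primitive. Doing it twice gives the
    second difference of a second primitive [H] of [G], which is twice differentiable although [G]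
    is only continuous. *)
Lemma uniform_smoothing (R : realType) (G : R -> R) :
  continuous G -> (forall x, 0 <= G x) ->
  exists p p' : R -> R,
    [/\ forall x : R, is_derive x 1 p (p' x),
        forall x : R, is_derive x 1 p' (G (x + 1 + 1) - G (x + 1) *+ 2 + G x) &
        forall x, (\int[uniform_prob (@ltr01 R)]_v
          \int[uniform_prob (@ltr01 R)]_u (G (x + v + u))%:E = (p x)%:E)%E].
Proof.
move=> cG G0.
have [F dF] := continuous_antiderivative cG.
have cF x : {for x, continuous F} by exact: is_derive_continuous (dF x).
have [H dH] := continuous_antiderivative cF.
have shift1 (f f' : R -> R) : (forall x : R, is_derive x 1 f (f' x)) ->
    forall x : R, is_derive x 1 (fun t => f (t + 1) - f t) (f' (x + 1) - f' x).
  move=> df x.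
  have df1 : is_derive x 1 (fun t => f (t + 1)) (f' (x + 1)).
    have -> : f' (x + 1) = f' (x + 1) * (1 + 0) by rewrite addr0 mulr1.
    by apply: (@is_derive1_comp _ f (fun t => t + 1)).
  exact: is_deriveB.
pose D (f : R -> R) t := f (t + 1) - f t.
exists (D (D H)), (D (D F)); split.
- by apply: (shift1 (D H) (D F)); exact: shift1.
- move=> x; rewrite (_ : _ + _ = G (x + 1 + 1) - G (x + 1) - (G (x + 1) - G x)).
    exact: (shift1 _ _ (shift1 _ _ dF)).
  by ring.
- move=> x; under eq_integral do rewrite (integral_uniform01_derive _ dF)//.
  (* [D F] is an average of [G], hence nonnegative, so the averaging formula applies a second
     time. *)
  have DF0 t : 0 <= D F t.
    rewrite -lee_fin /D -(integral_uniform01_derive _ dF)//.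
    by apply: integral_ge0 => u _; rewrite lee_fin.
  have cDF : continuous (D F).
    by move=> t; exact: is_derive_continuous (shift1 _ _ dF t).
  exact: (integral_uniform01_derive x (shift1 _ _ dH) cDF DF0).
Qed.

(** * Laws with a density *)

(** The proofs [mh] and [h0] are arguments so that the measure structure below can be attached to
    this name. *)
Definition density_measure d (T : measurableType d) (R : realType)
    (mu : {measure set T -> \bar R}) (h : T -> R)
    (mh : measurable_fun setT h) (h0 : forall x, 0 <= h x) : set T -> \bar R :=
  fun A => (\int[mu]_(x in A) (h x)%:E)%E.

Section density_measure.
Context d (T : measurableType d) (R : realType).
Variables (mu : {measure set T -> \bar R}) (h : T -> R).
Hypotheses (mh : measurable_fun setT h) (h0 : forall x, 0 <= h x).
Local Open Scope ereal_scope.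
Local Notation nu := (density_measure mu mh h0).

Let density0 : nu set0 = 0.
Proof. exact: integral_set0. Qed.

Let density_ge0 A : 0 <= nu A.
Proof. by apply: integral_ge0 => x _; rewrite lee_fin. Qed.

Let density_sigma_additive : semi_sigma_additive nu.
Proof.
move=> F mF tF mUF; rewrite /density_measure; apply: cvg_toP.
  apply: ereal_nondecreasing_is_cvgn => m n mn.
  apply: lee_sum_nneg_natr => // k _ _.
  by apply: integral_ge0 => x _; rewrite lee_fin.
rewrite ge0_integral_bigcup//=.
- by apply: measurable_funTS; exact/measurable_EFinP.
- by move=> x _; rewrite lee_fin.
Qed.

HB.instance Definition _ := isMeasure.Build _ _ _ nu
  density0 density_ge0 density_sigma_additive.

Import HBNNSimple.

Let integral_density_indic E : measurable E ->
  \int[nu]_x (\1_E x)%:E = \int[mu]_x ((\1_E x)%:E * (h x)%:E).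
Proof.
move=> mE; rewrite integral_indic// setIT /density_measure [LHS]integral_mkcond.
apply: eq_integral => x _; rewrite patchE indicE.
by case: ifP => _; rewrite ?mul1e ?mul0e.
Qed.

Let integral_density_nnsfun (f : {nnsfun T >-> R}) :
  \int[nu]_x (f x)%:E = \int[mu]_x ((f x)%:E * (h x)%:E).
Proof.
under [LHS]eq_integral do rewrite fimfunE -fsumEFin//.
rewrite [LHS]ge0_integral_fsum//; last 2 first.
  - by move=> r; exact/measurable_EFinP/measurableT_comp.
  - by move=> n x _; rewrite EFinM nnfun_muleindic_ge0.
under [RHS]eq_integral.
  move=> x xD; rewrite fimfunE -fsumEFin// ge0_mule_fsuml; last first.
    by move=> r; rewrite EFinM nnfun_muleindic_ge0.
  over.
rewrite [RHS]ge0_integral_fsum//; last 2 first.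
  - move=> r; apply: emeasurable_funM; last exact/measurable_EFinP.
    by apply/measurable_EFinP; do 2 apply/measurableT_comp => //.
  - move=> n x _; rewrite EFinM mule_ge0//; last by rewrite lee_fin.
    exact: nnfun_muleindic_ge0.
apply: eq_fsbigr => r _.
rewrite integralZl_indic_nnsfun//= integral_density_indic//.
have [r0|r0] := leP 0%R r.
  rewrite -ge0_integralZl//.
  - by apply: eq_integral => x _; rewrite EFinM muleA.
  - apply: emeasurable_funM; last exact/measurable_EFinP.
    exact/measurable_EFinP.
  - by move=> x _; rewrite mule_ge0// lee_fin.
(* A nonnegative simple function never takes the negative value [r], so both sides vanish. *)
rewrite preimage_nnfun0// indic0/=.
by rewrite !integral0_eq ?mule0// => x _; rewrite ?mulr0 mul0e.
Qed.

(** Extension from indicators to simple functions, then monotone convergence along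
    [nnsfun_approx]. *)
Lemma ge0_integral_density (f : T -> \bar R) :
  measurable_fun setT f -> (forall x, 0 <= f x) ->
  \int[nu]_x f x = \int[mu]_x (f x * (h x)%:E).
Proof.
move=> mf f0; pose f_ := nnsfun_approx measurableT mf.
transitivity (lim (\int[nu]_x (f_ n x)%:E @[n --> \oo])).
  rewrite -monotone_convergence//=.
  - apply: eq_integral => ? /[!inE] xD; apply/esym/cvg_lim => //=.
    exact: cvg_nnsfun_approx.
  - by move=> n; exact/measurable_EFinP/measurable_funTS.
  - by move=> n ? _; rewrite lee_fin.
  - by move=> ? _ ? ? mn; rewrite lee_fin; exact/lefP/nd_nnsfun_approx.
transitivity (lim (\int[mu]_x ((f_ n x)%:E * (h x)%:E) @[n --> \oo])).
  by apply: congr_lim; apply/funext => n; exact: integral_density_nnsfun.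
rewrite -monotone_convergence//=.
- apply: eq_integral => x _; apply/cvg_lim => //=.
  apply: cvgeZr => //; exact: cvg_nnsfun_approx.
- move=> n; apply: emeasurable_funM; last exact/measurable_EFinP.
  exact/measurable_EFinP/measurable_funTS.
- by move=> n x _; rewrite mule_ge0// lee_fin.
- move=> x _ m n mn; rewrite lee_wpmul2r ?lee_fin//.
  exact/lefP/nd_nnsfun_approx.
Qed.

End density_measure.

(** The image of Lebesgue measure under a shift has the same values on the intervals []a, b]], which
    determine the measure. *)
Lemma ge0_integral_lebesgue_shift (R : realType) (f : R -> \bar R) (y : R) :
  measurable_fun setT f -> (forall x, 0 <= f x)%E ->
  (\int[lebesgue_measure]_x f (x + y)%R = \int[lebesgue_measure]_x f x)%E.
Proof.
move=> mf f0.
have ms : measurable_fun setT (fun x : measurableTypeR R => x + y :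
  measurableTypeR R).
  exact: measurable_funD.
rewrite [RHS](eq_measure_integral
  (pushforward lebesgue_measure (fun x : measurableTypeR R => x + y :
    measurableTypeR R))).
  by rewrite ge0_integral_pushforward.
move=> A mA _; apply: lebesgue_measure_unique => //= _ [[a b]] _ <-.
rewrite /pushforward.
rewrite (_ : _ @^-1` _ = `]a - y, b - y]%classic); last first.
  by apply/seteqP; split => x /=; rewrite !in_itv/= ltrBlDr lerBrDr.
rewrite !lebesgue_measure_itv/= !lte_fin ltrD2r -!EFinB.
by case: ifP => // _; congr EFin; ring.
Qed.

(** * Submultiplicative weights *)

Section weight.
Context (R : realType) (c : nat -> R).
Hypothesis c01 : forall n, 0 < c n <= 2^-1 ^+ n.+1.
Implicit Types x y B : R.

Definition partial_weight n x : R := \prod_(i < n) (1 + c i * `|x|).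

(** An infinite product, taken as the limit of nondecreasing partial products. Since the [c n] sum
    to at most 1, [expR |x|] bounds them all and the limit is finite. *)
Definition weight x : R := limn (partial_weight ^~ x).

Let c0 n : 0 <= c n.
Proof. by have /andP[/ltW] := c01 n. Qed.

Let factor_ge1 n x : 1 <= 1 + c n * `|x|.
Proof. by rewrite lerDl mulr_ge0. Qed.

Lemma partial_weightS n x :
  partial_weight n.+1 x = partial_weight n x * (1 + c n * `|x|).
Proof. by rewrite /partial_weight big_ord_recr. Qed.

Lemma partial_weight_ge1 n x : 1 <= partial_weight n x.
Proof.
elim: n => [|n ih]; first by rewrite /partial_weight big_ord0.
by rewrite partial_weightS -[leLHS]mulr1 ler_pM.
Qed.

Let nd_partial_weight x : nondecreasing_seq (partial_weight ^~ x).
Proof.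
apply/nondecreasing_seqP => n; rewrite partial_weightS ler_peMr//.
exact: le_trans ler01 (partial_weight_ge1 _ _).
Qed.

Lemma partial_weight_le_expR n x : partial_weight n x <= expR `|x|.
Proof.
(* Strengthened for the induction: [1 - 2^-n] is the sum of the bounds on the first [n]
   coefficients, and each factor obeys [1 + u <= expR u]. *)
suff: partial_weight n x <= expR ((1 - 2^-1 ^+ n) * `|x|).
  move/le_trans; apply; rewrite ler_expR ler_piMl// gerBl.
elim: n => [|n ih]; first by rewrite /partial_weight big_ord0 expr0 subrr mul0r
  expR0.
rewrite partial_weightS.
have -> : (1 - 2^-1 ^+ n.+1) * `|x| = (1 - 2^-1 ^+ n) * `|x| + 2^-1 ^+ n.+1 *
  `|x|.
  by rewrite exprS; field.
rewrite expRD ler_pM//.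
- exact: le_trans ler01 (partial_weight_ge1 _ _).
- exact: le_trans ler01 (factor_ge1 _ _).
- apply: le_trans (expR_ge1Dx _); rewrite lerD2l ler_wpM2r//.
  by have /andP[] := c01 n.
Qed.

Let cvg_partial_weight x : cvgn (partial_weight ^~ x).
Proof.
apply: nondecreasing_is_cvgn => //; exists (expR `|x|) => _ [n _ <-].
exact: partial_weight_le_expR.
Qed.

Lemma partial_weight_le n x : partial_weight n x <= weight x.
Proof. exact: (nondecreasing_cvgn_le (@nd_partial_weight x)). Qed.

Let weight_le x B : (forall n, partial_weight n x <= B) -> weight x <= B.
Proof. by move=> h; apply: limr_le => //; apply: nearW. Qed.

Lemma weight_ge1 x : 1 <= weight x.
Proof. exact: le_trans (partial_weight_ge1 0 x) (partial_weight_le 0 x). Qed.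

Let weight_ge0 x : 0 <= weight x.
Proof. exact: le_trans ler01 (weight_ge1 _). Qed.

Lemma weight_le_expR x : weight x <= expR `|x|.
Proof. by apply: weight_le => n; exact: partial_weight_le_expR. Qed.

Lemma le_weight x y : `|x| <= `|y| -> weight x <= weight y.
Proof.
move=> xy; apply: weight_le => n; apply: le_trans (partial_weight_le n y).
apply: ler_prod => i _; rewrite (le_trans ler01 (factor_ge1 i x))/=.
by rewrite lerD2l ler_wpM2l.
Qed.

(** Factor by factor, [1 + c i (|x| + |y|) <= (1 + c i |x|) (1 + c i |y|)]. *)
Lemma weightD x y : weight (x + y) <= weight x * weight y.
Proof.
apply: weight_le => n.
apply: (@le_trans _ _ (partial_weight n x * partial_weight n y)).
  rewrite /partial_weight -big_split/=; apply: ler_prod => i _.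
  rewrite (le_trans ler01 (factor_ge1 i _))/=.
  apply: (@le_trans _ _ (1 + c i * (`|x| + `|y|))).
    by rewrite lerD2l ler_wpM2l// ler_normD.
  have : 0 <= (c i * `|x|) * (c i * `|y|) by rewrite !mulr_ge0.
  by nra.
by rewrite ler_pM// ?partial_weight_le// (le_trans ler01)// partial_weight_ge1.
Qed.

Lemma measurable_partial_weight n : measurable_fun setT (partial_weight n).
Proof.
rewrite /partial_weight; apply: measurable_prod => i _.
apply: measurable_funD => //; exact: measurable_funM.
Qed.

Lemma measurable_weight : measurable_fun setT weight.
Proof.
apply: (measurable_fun_cvg measurable_partial_weight) => x _.
exact: cvg_partial_weight.
Qed.

(** Each of the first [n] factors is at least [c i (1 + |x|)] because [c i <= 1]; the remaining
    factors are at least 1. *)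
Lemma weight_superpolynomial n :
  exists2 k, 0 < k & forall x, k * (1 + `|x|) ^+ n <= weight x.
Proof.
exists (\prod_(i < n) c i); first by apply: prodr_gt0 => i _; have /andP[] :=
  c01 i.
move=> x; apply: le_trans (partial_weight_le n x).
rewrite -[n in _ ^+ n]card_ord -prodr_const -big_split/=.
apply: ler_prod => i _; rewrite mulr_ge0 ?addr_ge0//=.
rewrite mulrDr mulr1 lerD2r; have /andP[_ /le_trans] := c01 i; apply.
by rewrite exprn_ile1// ?invr_ge0// invf_le1// ler1n.
Qed.

(** The factor of index [n] adds [c n |x|^3] times a partial product bounded by [(1 + |x|)^n]. Each
    error term thus pairs [c n] with a moment that does not depend on the coefficients. *)
Lemma sqr_partial_weight_le n x : x ^+ 2 * partial_weight n x <=
  x ^+ 2 + \sum_(i < n) c i * (`|x| ^+ 3 * (1 + `|x|) ^+ i).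
Proof.
have le1D m : partial_weight m x <= (1 + `|x|) ^+ m.
  elim: m => [|m ih]; first by rewrite /partial_weight big_ord0 expr0.
  rewrite partial_weightS exprSr ler_pM//.
  - exact: le_trans ler01 (partial_weight_ge1 _ _).
  - exact: le_trans ler01 (factor_ge1 _ _).
  - rewrite lerD2l ler_piMl//; have /andP[_ /le_trans] := c01 m; apply.
    by rewrite exprn_ile1// ?invr_ge0// invf_le1// ler1n.
elim: n => [|n ih]; first by rewrite /partial_weight !big_ord0 mulr1 addr0.
rewrite partial_weightS big_ord_recr/= addrA mulrA mulrDr mulr1 lerD//.
have -> : x ^+ 2 * partial_weight n x * (c n * `|x|) =
          c n * (`|x| ^+ 3 * partial_weight n x).
  by rewrite -(real_normK (num_real x)); ring.
by rewrite ler_wpM2l// ler_wpM2l.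
Qed.

Lemma le_integral_sqr_weight (m : {measure set R -> \bar R}) B :
  (forall n, \int[m]_x (x ^+ 2 * partial_weight n x)%:E <= B%:E)%E ->
  (\int[m]_x (x ^+ 2 * weight x)%:E <= B%:E)%E.
Proof.
move=> h.
have mp n : measurable_fun setT (fun x => (x ^+ 2 * partial_weight n x)%:E).
  apply/measurable_EFinP; apply: measurable_funM; first exact: measurable_funX.
  exact: measurable_partial_weight.
have p0 n x : (0 <= (x ^+ 2 * partial_weight n x)%:E)%E.
  rewrite lee_fin mulr_ge0 ?sqr_ge0//.
  exact: le_trans ler01 (partial_weight_ge1 _ _).
have nd x : {homo (fun n => (x ^+ 2 * partial_weight n x)%:E) :
    n k / (n <= k)%N >-> (n <= k)%E}.
  by move=> n k nk; rewrite lee_fin ler_wpM2l ?sqr_ge0// nd_partial_weight.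
rewrite (eq_integral (fun x => limn (fun n => (x ^+ 2 * partial_weight n
  x)%:E))).
  rewrite monotone_convergence//.
  apply: lime_le; last by apply: nearW.
  apply: ereal_nondecreasing_is_cvgn => n k nk.
  by apply: ge0_le_integral => // x _; exact: nd.
move=> x _; apply/esym/cvg_lim => //; apply: cvg_EFin; first exact: nearW.
by apply: cvgM; [exact: cvg_cst|exact: cvg_partial_weight].
Qed.

End weight.

(** The coefficients are chosen after the moments of [m], so that the error terms of
    [sqr_partial_weight_le] integrate to at most [eps] in total. It is applied to the sum of two
    laws, so that one weight serves both. *)
Lemma exists_weight (R : realType) (m : {measure set R -> \bar R}) (eps : R) :
  0 < eps -> (forall n, \int[m]_x (`|x| ^+ n)%:E < +oo)%E ->
  exists w : R -> R,
    [/\ measurable_fun setT w,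
        [/\ forall x, 1 <= w x, forall x, w x <= expR `|x|,
            forall x y, w (x + y) <= w x * w y &
            forall x y, `|x| <= `|y| -> w x <= w y],
        forall n, exists2 k, 0 < k & forall x, k * (1 + `|x|) ^+ n <= w x &
        (\int[m]_x (x ^+ 2 * w x)%:E <= \int[m]_x (x ^+ 2)%:E + eps%:E)%E].
Proof.
move=> eps0 fin.
have mX n : measurable_fun setT (fun x : R => `|x| ^+ n).
  exact: measurable_funX.
have mP i : measurable_fun setT (fun x : R => (`|x| ^+ 3 * (1 + `|x|) ^+ i)).
  apply: measurable_funM => //; apply: measurable_funX.
  exact: measurable_funD.
pose M i : \bar R := (\int[m]_x (`|x| ^+ 3 * (1 + `|x|) ^+ i)%:E)%E.
have M0 i : (0 <= M i)%E.
  by apply: integral_ge0 => x _; rewrite lee_fin mulr_ge0 ?exprn_ge0 ?addr_ge0.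
have Moo i : (M i < +oo)%E.
  (* Uses [(1 + |x|)^i <= 2^i (1 + |x|^i)], by cases on [|x| <= 1]. *)
  apply: (@le_lt_trans _ _ (\int[m]_x ((2 ^+ i)%:E *
      ((`|x| ^+ 3)%:E + (`|x| ^+ (3 + i))%:E)))%E).
    apply: ge0_le_integral => //.
    - by apply/measurable_EFinP.
    - apply: measurable_funeM; apply: emeasurable_funD;
        apply/measurable_EFinP => //.
    - move=> x _; rewrite -EFinD -EFinM lee_fin exprD -[X in _ * (X + _)]mulr1.
      rewrite -mulrDr mulrCA ler_wpM2l ?exprn_ge0//.
      have [x1|x1] := leP `|x| 1.
        apply: (@le_trans _ _ (2 ^+ i)); last by rewrite ler_peMr
          ?exprn_ge0// lerDl exprn_ge0.
        by rewrite lerXn2r ?nnegrE ?addr_ge0// -natr1 addrC lerD2r.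
      apply: (@le_trans _ _ ((2 * `|x|) ^+ i)).
        by rewrite lerXn2r ?nnegrE ?addr_ge0 ?mulr_ge0//; move: x1; lra.
      by rewrite exprMn ler_wpM2l ?exprn_ge0// lerDr.
  rewrite ge0_integralZl_EFin//; last 2 first.
  - by move=> x _; rewrite -EFinD lee_fin addr_ge0 ?exprn_ge0.
  - by apply: emeasurable_funD; apply/measurable_EFinP.
  rewrite ge0_integralD//; try by apply/measurable_EFinP.
  by rewrite lte_mul_pinfty ?lee_fin ?exprn_ge0// lte_add_pinfty.
have Mfin i : M i = (fine (M i))%:E.
  by rewrite fineK// ge0_fin_numE.
(* The minimum with 1 gives [c i <= 2^-(i+1)], and the quotient gives [c i * M i <= eps * 2^-(i+1)];
   the added 1 keeps the denominator positive. *)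
pose c i : R := 2^-1 ^+ i.+1 * Num.min 1 (eps / (1 + fine (M i))).
have M1 i : 0 < 1 + fine (M i) by rewrite ltr_wpDr// fine_ge0.
have h0 n : 0 < (2^-1 : R) ^+ n by rewrite exprn_gt0// invr_gt0.
have c01 n : 0 < c n <= 2^-1 ^+ n.+1.
  rewrite /c ler_piMr ?(ltW (h0 _)) ?ge_min ?lexx// andbT.
  by rewrite mulr_gt0// lt_min ltr01 divr_gt0.
have cM n : c n * fine (M n) <= 2^-1 ^+ n.+1 * eps.
  rewrite /c -mulrA ler_wpM2l ?(ltW (h0 _))//.
  apply: (@le_trans _ _ (eps / (1 + fine (M n)) * fine (M n))).
    by rewrite ler_wpM2r ?fine_ge0// ge_min lexx orbT.
  by rewrite mulrAC ler_pdivrMr// ler_wpM2l ?(ltW eps0)// lerDr.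
exists (weight c); split.
- exact: measurable_weight.
- split; [exact: weight_ge1|exact: weight_le_expR|exact: weightD|exact:
    le_weight].
- exact: weight_superpolynomial.
have S2 : (\int[m]_x (x ^+ 2)%:E)%E \is a fin_num.
  rewrite ge0_fin_numE; last by apply: integral_ge0 => x _;
    rewrite lee_fin sqr_ge0.
  by under eq_integral do rewrite -(real_normK (num_real _)).
rewrite -(fineK S2) -EFinD; apply: le_integral_sqr_weight => // n.
apply: (@le_trans _ _ (\int[m]_x ((x ^+ 2)%:E +
    \sum_(i < n) ((c i)%:E * (`|x| ^+ 3 * (1 + `|x|) ^+ i)%:E)))%E).
  apply: ge0_le_integral => //.
  - move=> x _; rewrite lee_fin mulr_ge0 ?sqr_ge0//.
    by rewrite (le_trans ler01)// partial_weight_ge1.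
  - apply/measurable_EFinP; apply: measurable_funM; first
      exact: measurable_funX.
    exact: measurable_partial_weight.
  - apply: emeasurable_funD; first by apply/measurable_EFinP;
      exact: measurable_funX.
    apply: emeasurable_sum => i; apply: measurable_funeM;
      apply/measurable_EFinP => //.
  - move=> x _; under eq_bigr do rewrite -EFinM; rewrite sumEFin -EFinD lee_fin.
    exact: sqr_partial_weight_le.
have c0 i : 0 <= c i by have /andP[/ltW] := c01 i.
have t0 i x : (0 <= (c i)%:E * (`|x| ^+ 3 * (1 + `|x|) ^+ i)%:E)%E.
  rewrite -EFinM lee_fin; apply: mulr_ge0; first exact: c0.
  by rewrite mulr_ge0 ?exprn_ge0 ?addr_ge0.
rewrite ge0_integralD//; last 4 first.
- by move=> x _; rewrite lee_fin sqr_ge0.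
- by apply/measurable_EFinP; exact: measurable_funX.
- by move=> x _; exact: sume_ge0.
- by apply: emeasurable_sum => i; apply: measurable_funeM;
    apply/measurable_EFinP.
rewrite EFinD (fineK S2) leeD2l//.
rewrite ge0_integral_sum//; last first.
  by move=> i; apply: measurable_funeM; apply/measurable_EFinP => //.
apply: (@le_trans _ _ (\sum_(i < n) (2^-1 ^+ i.+1 * eps)%:E)%E).
  apply: lee_sum => i _; rewrite ge0_integralZl_EFin//.
  - by rewrite -/(M i) Mfin -EFinM lee_fin.
  - by apply/measurable_EFinP.
rewrite sumEFin lee_fin -mulr_suml ler_piMl ?(ltW eps0)//.
suff -> : \sum_(i < n) (2^-1 : R) ^+ i.+1 = 1 - 2^-1 ^+ n by rewrite gerBl ltW.
elim: n => [|n ih]; first by rewrite big_ord0 expr0 subrr.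
by rewrite big_ord_recr/= ih exprS; field.
Qed.

(** * A law with slowly varying density *)

(** A second name that carries the proof [h1] of total mass 1, to which the probability structure is
    attached. *)
Definition density_prob d (T : measurableType d) (R : realType)
    (mu : {measure set T -> \bar R}) (h : T -> R)
    (mh : measurable_fun setT h) (h0 : forall x, 0 <= h x)
    (h1 : (\int[mu]_x (h x)%:E = 1)%E) : set T -> \bar R :=
  density_measure mu mh h0.

Section density_prob.
Context d (T : measurableType d) (R : realType).
Variables (mu : {measure set T -> \bar R}) (h : T -> R).
Hypotheses (mh : measurable_fun setT h) (h0 : forall x, 0 <= h x)
  (h1 : (\int[mu]_x (h x)%:E = 1)%E).

HB.instance Definition _ :=
  Measure.copy (density_prob mh h0 h1) (density_measure mu mh h0).

HB.instance Definition _ := @Measure_isProbability.Build _ _ R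
  (density_prob mh h0 h1) h1.

End density_prob.

Section harnack_law.
Context (R : realType) (w : R -> R).
Hypotheses (mw : measurable_fun setT w) (w1 : forall x, 1 <= w x)
  (wE : forall x, w x <= expR `|x|)
  (wD : forall x y, w (x + y) <= w x * w y)
  (wpoly : forall n, exists2 k, 0 < k & forall x, k * (1 + `|x|) ^+ n <= w x).
Local Notation mu := (@lebesgue_measure R).

Let w0 x : 0 < w x. Proof. exact: lt_le_trans ltr01 (w1 x). Qed.

Let mwV : measurable_fun setT (fun x => (w x)^-1).
Proof.
rewrite (_ : (fun x => _) = (fun x => powR (w x) (-1))).
  by apply: (measurableT_comp (measurable_powR _)).
by apply/funext => x; rewrite powR_inv1// ltW.
Qed.

Let mpoly n : measurable_fun setT (fun x : R => (1 + `|x|) ^+ n).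
Proof. by apply: measurable_funX; exact: measurable_funD. Qed.

(** Growth of [w] of order [n + 2] leaves the integrable majorant [1 / (1 + x^2)] up to a
    constant. *)
Lemma integral_poly_inv_weight n : (\int[mu]_x ((1 + `|x|) ^+ n / w x)%:E <
  +oo)%E.
Proof.
have [k k0 kw] := wpoly n.+2.
have mq : measurable_fun setT (fun x : R => (oneDsqr x)^-1).
  by apply: continuous_measurable_fun; exact: continuous_oneDsqrV.
apply: (@le_lt_trans _ _ (\int[mu]_x (k^-1%:E * (oneDsqr x)^-1%:E))%E).
  apply: ge0_le_integral => //.
  - by move=> x _; rewrite lee_fin divr_ge0 ?exprn_ge0 ?addr_ge0// ltW.
  - by apply/measurable_EFinP; apply: measurable_funM => //; exact: mpoly.
  - by apply: measurable_funeM; apply/measurable_EFinP.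
  - move=> x _; rewrite -EFinM lee_fin -invfM ler_pdivrMr// mulrC.
    have q0 : 0 < oneDsqr x by rewrite (lt_le_trans ltr01) ?oneDsqr_ge1.
    rewrite ler_pdivlMr ?mulr_gt0//; apply: le_trans (kw x).
    rewrite mulrCA ler_wpM2l ?(ltW k0)// -addn2 exprD ler_wpM2l//.
    rewrite /oneDsqr -(real_normK (num_real x)) sqrrD expr1n mul1r.
    by rewrite -addrA lerD2l lerDr mulrn_wge0.
have q0 x : 0 <= (oneDsqr x)^-1 :> R
  by rewrite invr_ge0 (le_trans ler01)// oneDsqr_ge1.
have kV0 : 0 <= k^-1 by rewrite invr_ge0 ltW.
have mqE : measurable_fun setT (fun x : R => (oneDsqr x)^-1%:E)
  by apply/measurable_EFinP.
rewrite ge0_integralZl_EFin//.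
rewrite ge0_symfun_integralT//; last 2 first.
- exact: continuous_oneDsqrV.
- by move=> x; rewrite /oneDsqr/= sqrrN.
by rewrite -set_itvcy integral0y_oneDsqr ltry.
Qed.

Let C := fine (\int[mu]_x (w x)^-1%:E)%E.

Let integral_inv_weight : (\int[mu]_x (w x)^-1%:E = C%:E)%E.
Proof.
rewrite fineK// ge0_fin_numE.
  by have := integral_poly_inv_weight 0;
    under eq_integral do rewrite expr0 mul1r.
by apply: integral_ge0 => x _; rewrite lee_fin invr_ge0 ltW.
Qed.

(** On [[0, 1]] the bound [w x <= expR |x|] keeps [1 / w] above [expR (- 1)]. *)
Let C0 : 0 < C.
Proof.
rewrite -lte_fin -integral_inv_weight.
apply: (@lt_le_trans _ _ (\int[mu]_(x in `[0%R, 1%R]) (cst (expR (-1))%:E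
  x))%E).
  rewrite integral_cst//= lebesgue_measure_itv/= lte_fin ltr01 sube0 mule1.
  by rewrite lte_fin expR_gt0.
apply: (@le_trans _ _ (\int[mu]_(x in `[0%R, 1%R]) (w x)^-1%:E)%E).
  apply: ge0_le_integral => //=.
  - by apply: measurable_funTS; apply/measurable_EFinP.
  - move=> x; rewrite in_itv/= => /andP[x0 x1].
    rewrite lee_fin expRN lef_pV2 ?posrE ?expR_gt0//.
    by rewrite (le_trans (wE x))// ler_expR ger0_norm.
apply: ge0_subset_integral => //.
- by apply/measurable_EFinP.
- by move=> x _; rewrite lee_fin invr_ge0 ltW.
Qed.

Let h x := (w x)^-1 / C.

Let mh : measurable_fun setT h.
Proof. exact: measurable_funM. Qed.

Let h0 x : 0 <= h x.
Proof. by rewrite /h divr_ge0 ?invr_ge0 ?ltW. Qed.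

Let h1 : (\int[mu]_x (h x)%:E = 1)%E.
Proof.
under eq_integral do rewrite /h mulrC EFinM.
rewrite ge0_integralZl_EFin//.
- by rewrite integral_inv_weight -EFinM mulVf ?gt_eqF.
- by move=> x _; rewrite lee_fin invr_ge0 ltW.
- by apply/measurable_EFinP.
- by rewrite invr_ge0 ltW.
Qed.

(** The law of density proportional to [1 / w], named after the Harnack-type inequality
    [harnack_law_shift]. *)
Definition harnack_law : probability (measurableTypeR R) R :=
  @density_prob _ (measurableTypeR R) R lebesgue_measure h mh h0 h1.

Lemma integral_harnack_law (f : R -> R) : measurable_fun setT f ->
  (forall x, 0 <= f x) ->
  (\int[harnack_law]_z (f z)%:E = \int[mu]_z (f z * h z)%:E)%E.
Proof.
move=> mf f0; rewrite ge0_integral_density//.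
by apply/measurable_EFinP.
Qed.

Lemma harnack_law_moment n : (\int[harnack_law]_z ((1 + `|z|) ^+ n)%:E < +oo)%E.
Proof.
rewrite integral_harnack_law//.
rewrite [ltLHS](_ : _ = \int[mu]_z (C^-1%:E * ((1 + `|z|) ^+ n / w z)%:E))%E;
  last first.
  by apply: eq_integral => x _; rewrite -EFinM /h; congr EFin; ring.
have CV0 : 0 <= C^-1 by rewrite invr_ge0 ltW.
have mp : measurable_fun setT (fun z : R => ((1 + `|z|) ^+ n / w z)%:E).
  by apply/measurable_EFinP; apply: measurable_funM => //; exact: mpoly.
rewrite ge0_integralZl_EFin//; last first.
  by move=> x _; rewrite lee_fin divr_ge0 ?exprn_ge0 ?addr_ge0// ltW.
by rewrite lte_mul_pinfty ?lee_fin// integral_poly_inv_weight.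
Qed.

(** After translation the two densities are proportional to [1 / w (z - x - y)] and [1 / w (z - x)],
    and submultiplicativity gives [w (z - x) <= w (z - x - y) * w y]. *)
Lemma harnack_law_shift (k : R -> R) x y : measurable_fun setT k ->
  (forall x, 0 <= k x) ->
  (\int[harnack_law]_z (k (x + y + z))%:E <=
   (w y)%:E * \int[harnack_law]_z (k (x + z))%:E)%E.
Proof.
move=> mk k0.
have mkx (t : R) : measurable_fun setT (fun z : R => k (t + z)).
  by apply: (measurableT_comp mk); exact: measurable_funD.
have mhx (t : R) : measurable_fun setT (fun z : R => h (z - t)).
  by apply: (measurableT_comp mh); exact: measurable_funB.
have mkh (t : R) : measurable_fun setT (fun z : R => (k z * h (z - t))%:E).
  by apply/measurable_EFinP; exact: measurable_funM.
have kh0 t z : (0 <= (k z * h (z - t))%:E)%E by rewrite lee_fin mulr_ge0.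
have shift t : (\int[harnack_law]_z (k (t + z))%:E = \int[mu]_z (k z * h (z -
  t))%:E)%E.
  rewrite integral_harnack_law//.
  rewrite -(@ge0_integral_lebesgue_shift _ (fun z : R => (k z * h (z - t))%:E)
    t)//.
  by apply: eq_integral => z _; rewrite addrK addrC.
rewrite !shift -ge0_integralZl_EFin//; last 2 first.
- exact: mkh.
- exact: ltW.
apply: ge0_le_integral => //.
- exact: mkh.
- by apply: measurable_funeM; exact: mkh.
- move=> z _; rewrite -EFinM lee_fin [leRHS]mulrCA ler_wpM2l//.
  rewrite /h mulrA ler_wpM2r ?invr_ge0 ?(ltW C0)//.
  have -> : z - x = z - (x + y) + y by ring.
  rewrite ler_pdivlMr// [leLHS]mulrC ler_pdivrMr// mulrC.
  exact: wD.
Qed.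

End harnack_law.

(** * Comparison after smoothing *)

Section smoothed_comparison.
Context (R : realType) (w : R -> R) (nu : probability (measurableTypeR R) R).
Hypotheses (mw : measurable_fun setT w) (w1 : forall x, 1 <= w x)
  (wE : forall x, w x <= expR `|x|)
  (w_le : forall x y, `|x| <= `|y| -> w x <= w y)
  (nu_shift : forall (k : R -> R) x y, measurable_fun setT k ->
    (forall x, 0 <= k x) ->
    (\int[nu]_z (k (x + y + z))%:E <= (w y)%:E * \int[nu]_z (k (x + z))%:E)%E).
Implicit Types g : R -> R.

Local Notation U := (uniform_prob (@ltr01 R)).

Definition smoothed g (x : R) : \bar R :=
  (\int[U]_v \int[U]_u \int[nu]_z (g (x + v + u + z))%:E)%E.

Let w0 x : 0 < w x. Proof. exact: lt_le_trans ltr01 (w1 x). Qed.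

Let measurable_shift g (t : R) : measurable_fun setT g ->
  measurable_fun setT (fun z : R => g (t + z)).
Proof. by move=> mg; apply: (measurableT_comp mg); exact: measurable_funD. Qed.

(* Second differences inherit from [nu_shift] a two-sided control by [w],
   which becomes a control of the Taylor remainder of [smoothed g]. *)
Lemma smoothed_taylor g : measurable_fun setT g -> (forall x, 0 <= g x) ->
  (forall x, 0 <= g (x + 1 + 1) - g (x + 1) *+ 2 + g x) ->
  (exists x, \int[nu]_z (g (x + z))%:E < +oo)%E ->
  exists p0 p1 K : R, 0 <= K /\ exists2 p : R -> R,
    measurable_fun setT p /\ (forall x, smoothed g x = (p x)%:E) &
    forall x, p0 + p1 * x + K / 2 * (x ^+ 2 * (2 - w x)) <= p x
           <= p0 + p1 * x + K / 2 * (x ^+ 2 * w x).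
Proof.
move=> mg g0 d2g [x0 fin0].
have I0 (k : R -> R) : (forall x, 0 <= k x) ->
  forall x : R, (0 <= \int[nu]_z (k (x + z))%:E)%E.
  by move=> k0 x; apply: integral_ge0 => z _; rewrite lee_fin.
(* Finiteness at the single point [x0] spreads to every point by [nu_shift]. *)
have fin x : (\int[nu]_z (g (x + z))%:E < +oo)%E.
  rewrite -(subrK x0 x) addrC; apply: le_lt_trans (nu_shift _ _ mg g0) _.
  by rewrite lte_mul_pinfty ?lee_fin// ltW.
pose G x := fine (\int[nu]_z (g (x + z))%:E)%E.
have GE x : (\int[nu]_z (g (x + z))%:E = (G x)%:E)%E.
  by rewrite fineK// ge0_fin_numE ?I0.
have G0 x : 0 <= G x by rewrite fine_ge0// I0.
have GD x y : G (x + y) <= w y * G x.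
  by rewrite -lee_fin EFinM -!GE nu_shift.
(* Since [w] is at most the exponential of the absolute value, [G y] is squeezed between
   [expR (- |y - x|) * G x] and [expR |y - x| * G x]. *)
have cG : continuous G.
  move=> x.
  have cd : `|y - x| @[y --> x] --> (0 : R).
    rewrite -(normr0 R) -(subrr x); apply: cvg_norm.
    by apply: cvgB; [exact: cvg_id|exact: cvg_cst].
  have cl : expR (- `|y - x|) * G x @[y --> x] --> G x.
    rewrite -[X in _ --> X]mul1r -expR0 -oppr0; apply: cvgM; last
      exact: cvg_cst.
    exact: (cvg_comp _ _ (cvgN cd) (@continuous_expR R (- 0))).
  have cu : expR `|y - x| * G x @[y --> x] --> G x.
    rewrite -[X in _ --> X]mul1r -expR0; apply: cvgM; last exact: cvg_cst.
    exact: (cvg_comp _ _ cd (@continuous_expR R 0)).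
  apply: (squeeze_cvgr _ cl cu); apply: nearW => y; apply/andP; split.
    rewrite expRN mulrC ler_pdivrMr ?expR_gt0// mulrC.
    have := GD y (x - y); rewrite subrKC => /le_trans; apply.
    by rewrite ler_wpM2r// distrC.
  by have := GD x (y - x); rewrite subrKC => /le_trans; apply;
    rewrite ler_wpM2r.
(* By [d2g] the second difference [k] is nonnegative, so [nu_shift] applies to it too and compares
   [K y] with [K 0] in both directions. *)
pose k x := g (x + 1 + 1) - g (x + 1) *+ 2 + g x.
have mgc (c : R) : measurable_fun setT (fun x : R => g (x + c)).
  by apply: (measurableT_comp mg); exact: measurable_funD.
have mk : measurable_fun setT k.
  rewrite (_ : k = (fun x => g (x + (1 + 1)) - (g (x + 1) + g (x + 1)) + g x)).
    by apply: measurable_funD => //; apply: measurable_funB => //;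
      exact: measurable_funD.
  by apply/funext => x; rewrite /k mulr2n addrA.
pose K x := G (x + 1 + 1) - G (x + 1) *+ 2 + G x.
have kE x : (\int[nu]_z (k (x + z))%:E = (K x)%:E)%E.
  have mE (f : R -> R) : measurable_fun setT f -> forall t : R,
      measurable_fun setT (fun z : R => (f (t + z))%:E).
    by move=> mf t; apply/measurable_EFinP; exact: (measurable_shift t mf).
  have : (\int[nu]_z (k (x + z))%:E + (G (x + 1) + G (x + 1))%:E =
          (G (x + 1 + 1) + G x)%:E)%E.
    have gE0 (t z : R) : (0 <= (g (t + z))%:E)%E by rewrite lee_fin.
    rewrite !EFinD -!GE -!ge0_integralD//; try exact: mE.
    - apply: eq_integral => z _; rewrite -!EFinD; congr EFin.
      have -> : x + 1 + 1 + z = x + z + 1 + 1 by ring.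
      by have -> : x + 1 + z = x + z + 1; [ring|rewrite /k; ring].
    - by move=> z _; exact: d2g.
    - by move=> z _; rewrite adde_ge0.
    - by apply: emeasurable_funD; exact: mE.
  (* The identity just proved has a finite right-hand side, which rules out an infinite integral of
     [k]. *)
  have := I0 k d2g x; case: (\int[nu]_z (k (x + z))%:E)%E => //= r _ [] E.
  by congr EFin; rewrite /K mulr2n; lra.
have K0 x : 0 <= K x by rewrite -lee_fin -kE I0.
have wN y : w (- y) = w y.
  by apply/eqP; rewrite eq_le !w_le ?normrN.
have Kle y : K y <= w y * K 0.
  by rewrite -lee_fin EFinM -!kE; have := @nu_shift k 0 y mk d2g; rewrite add0r.
have Kge y : K 0 <= w y * K y.
  by rewrite -lee_fin EFinM -!kE -(wN y); have := @nu_shift k y (- y) mk d2g;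
    rewrite subrr.
have [p [p' [dp dp' pE]]] := uniform_smoothing cG G0.
exists (p 0), (p' 0), (K 0); split => //; exists p.
  split; first by apply: continuous_measurable_fun => x;
    exact: is_derive_continuous (dp x).
  move=> x; rewrite -pE; apply: eq_integral => v _; apply: eq_integral => u _.
  exact: GE.
move=> x; apply/andP; split.
  (* From [(w x - 1)^2 >= 0]. With [2 - w x] in place of [1 / w x], the later comparison involves
     only the integrals of [x^2] and of [x^2 * w x]. *)
  have wV : 2 - w x <= (w x)^-1.
    rewrite -(ler_pM2r (w0 x)) mulVf ?gt_eqF//.
    by have := sqr_ge0 (w x - 1); nra.
  apply: le_trans (taylor2_ge (m := K 0 / w x) dp dp' _).
    rewrite lerD2l [leRHS](_ : _ = K 0 / 2 * (x ^+ 2 * (w x)^-1)); last by ring.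
    by rewrite ler_wpM2l ?divr_ge0// ler_wpM2l ?sqr_ge0.
  move=> y yx; rewrite ler_pdivrMr// mulrC; apply: le_trans (Kge y) _.
  by rewrite ler_wpM2r// w_le.
apply: le_trans (taylor2_le (M := K 0 * w x) dp dp' _) _.
  move=> y yx; rewrite mulrC; apply: le_trans (Kle y) _.
  by rewrite ler_wpM2r// w_le.
by rewrite lerD2l le_eqVlt; apply/orP; left; apply/eqP; ring.
Qed.

(** Contrapositive: if the inner integral is infinite at every point, so is its average. *)
Lemma smoothed_fin g x : measurable_fun setT g -> (forall x, 0 <= g x) ->
  (smoothed g x < +oo)%E -> exists y, (\int[nu]_z (g (y + z))%:E < +oo)%E.
Proof.
move=> mg g0; apply: contraPP => /forallNP noo.
rewrite /smoothed (eq_integral (cst +oo%E)) ?integral_prob_cst//= => v _.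
rewrite (eq_integral (cst +oo%E)) ?integral_prob_cst//= => u _.
by apply/eqP; rewrite -leye_eq leNgt; apply/negP; exact: noo.
Qed.

(* The hypothesis on [w] bounds the second-order remainders, using
   [1 / w >= 2 - w]. *)
Lemma le_integral_smoothed (a b : probability R R) g :
  measurable_fun setT g -> (forall x, 0 <= g x) ->
  (forall x, 0 <= g (x + 1 + 1) - g (x + 1) *+ 2 + g x) ->
  a.-integrable setT EFin -> b.-integrable setT EFin ->
  (\int[a]_x x%:E = \int[b]_x x%:E)%E ->
  (\int[a]_x (x ^+ 2 * w x)%:E + \int[b]_x (x ^+ 2 * w x)%:E <=
   2%:E * \int[b]_x (x ^+ 2)%:E < +oo)%E ->
  (\int[a]_x smoothed g x <= \int[b]_x smoothed g x)%E.
Proof.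
move=> mg g0 d2g ia ib mean /andP[var fin].
have s0 x : (0 <= smoothed g x)%E.
  by do 3 (apply: integral_ge0 => ? _); rewrite lee_fin.
(* If the inner integral is infinite everywhere, the right-hand side is infinite and nothing remains
   to prove. *)
have [noo|noo] := pselect (exists x, \int[nu]_z (g (x + z))%:E < +oo)%E;
  last first.
  have soo x : smoothed g x = +oo%E.
    apply/eqP; rewrite -leye_eq leNgt; apply/negP => fx.
    by apply: noo; exact: smoothed_fin fx.
  under [leRHS]eq_integral do rewrite soo.
  by rewrite (integral_prob_cst b +oo%E) leey.
have [p0 [p1 [K [K0 [p [mp pE] pbound]]]]] := smoothed_taylor mg g0 d2g noo.
under eq_integral do rewrite pE; under [leRHS]eq_integral do rewrite pE.
have pp0 x : 0 <= p x by rewrite -lee_fin -pE.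
have mx2w : measurable_fun setT (fun x : R => x ^+ 2 * w x).
  by apply: measurable_funM => //; exact: measurable_funX.
have x2w0 x : 0 <= x ^+ 2 * w x by rewrite mulr_ge0 ?sqr_ge0// ltW.
have iw (c : probability R R) : (\int[c]_x (x ^+ 2 * w x)%:E < +oo)%E ->
    c.-integrable setT (fun x => (x ^+ 2 * w x)%:E).
  move=> h; apply/integrableP; split; first exact/measurable_EFinP.
  by under eq_integral do rewrite gee0_abs ?lee_fin//.
have iwa : a.-integrable setT (fun x => (x ^+ 2 * w x)%:E).
  apply: iw; apply: le_lt_trans fin; apply: le_trans var.
  by rewrite leeDl// integral_ge0// => x _; rewrite lee_fin.
have iwb : b.-integrable setT (fun x => (x ^+ 2 * w x)%:E).
  apply: iw; apply: le_lt_trans fin; apply: le_trans var.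
  by rewrite leeDr// integral_ge0// => x _; rewrite lee_fin.
have ix2 (c : probability R R) : c.-integrable setT (fun x => (x ^+ 2 * w
  x)%:E) ->
    c.-integrable setT (fun x : R => (x ^+ 2)%:E).
  move=> ic; apply: le_integrable ic => //.
    by apply/measurable_EFinP; exact: measurable_funX.
  move=> x _; rewrite !abse_EFin lee_fin !ger0_norm ?sqr_ge0//.
  by rewrite ler_peMr ?sqr_ge0.
have icst (c : probability R R) (r : R) : c.-integrable setT (fun=> r%:E).
  apply/integrableP; split; first exact: measurable_cst.
  by rewrite (integral_prob_cst c `|r%:E|%E) ltry.
have lin (c : probability R R) (q : R -> R) : c.-integrable setT EFin ->
    c.-integrable setT (fun x => (q x)%:E) ->
    c.-integrable setT (fun x => (p0 + p1 * x + K / 2 * q x)%:E) /\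
    (\int[c]_x (p0 + p1 * x + K / 2 * q x)%:E =
     p0%:E + p1%:E * \int[c]_x x%:E + (K / 2)%:E * \int[c]_x (q x)%:E)%E.
  move=> ic iq.
  have i1 := integrableZl measurableT p1 ic.
  have i2 := integrableZl measurableT (K / 2) iq.
  have i3 := integrableD measurableT (icst c p0) i1.
  have -> : (fun x => (p0 + p1 * x + K / 2 * q x)%:E) =
      (((fun=> p0%:E) \+ (fun x => p1%:E * x%:E)) \+ (fun x => (K / 2)%:E * (q
        x)%:E))%E.
    by apply/funext => x; rewrite !EFinD !EFinM.
  split; first exact: integrableD.
  rewrite integralD// integralD//; last exact: icst.
  by rewrite (integral_prob_cst c p0%:E) !integralZl.
have [iua Ea] := lin a _ ia iwa.
have ilb : b.-integrable setT (fun x => (x ^+ 2 * (2 - w x))%:E).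
  have -> : (fun x => (x ^+ 2 * (2 - w x))%:E) =
      ((fun x => 2%:E * (x ^+ 2)%:E) \- (fun x => (x ^+ 2 * w x)%:E))%E.
    by apply/funext => x; rewrite -EFinM -EFinB; congr EFin; ring.
  apply: integrableB => //; apply: integrableZl => //; exact: ix2.
have [iub Eb] := lin b _ ib ilb.
have [ioo|] := ltP (\int[b]_x (p x)%:E)%E +oo%E; last
  by rewrite leye_eq => /eqP ->; rewrite leey.
have ipb : b.-integrable setT (fun x => (p x)%:E).
  apply/integrableP; split; first exact/measurable_EFinP.
  by under eq_integral do rewrite gee0_abs ?lee_fin//.
have ipa : a.-integrable setT (fun x => (p x)%:E).
  apply: le_integrable iua => //; first exact/measurable_EFinP.
  move=> x _; rewrite !abse_EFin lee_fin ger0_norm//.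
  by apply: le_trans (ler_norm _); have /andP[] := pbound x.
apply: (@le_trans _ _ (\int[a]_x (p0 + p1 * x + K / 2 * (x ^+ 2 * w x))%:E)%E).
  by apply: le_integral => // x _; rewrite lee_fin; have /andP[] := pbound x.
apply: (@le_trans _ _ (\int[b]_x (p0 + p1 * x + K / 2 * (x ^+ 2 * (2 - w
  x)))%:E)%E); last first.
  by apply: le_integral => // x _; rewrite lee_fin; have /andP[] := pbound x.
(* Constant and linear terms agree because the means do; what remains between the quadratic terms is
   [var] rearranged. *)
rewrite Ea Eb mean leeD2l// lee_wpmul2l ?lee_fin ?divr_ge0//.
rewrite [leRHS](_ : _ = 2%:E * \int[b]_x (x ^+ 2)%:E - \int[b]_x (x ^+ 2 * w
  x)%:E)%E.
  by rewrite leeBrDr// integrable_fin_num.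
rewrite -integralZl//; last exact: ix2.
rewrite -integralB//; last by apply: integrableZl => //; exact: ix2.
by apply: eq_integral => x _; rewrite -EFinM -EFinB; congr EFin; ring.
Qed.

End smoothed_comparison.

(** * Losses and second-order dominance *)

(** A class stable under translation, whose integrals always make sense in [[0, +oo]], so that
    Tonelli applies freely; dominance is recovered from it in [ssd_ge_loss]. *)
Definition loss_function (R : realType) (g : R -> R) : Prop :=
  [/\ forall t x y : R, 0 <= t <= 1 ->
        g (t * x + (1 - t) * y) <= t * g x + (1 - t) * g y,
      nonincreasing_fun g & forall x, 0 <= g x].

Lemma measurable_loss (R : realType) (g : R -> R) :
  loss_function g -> measurable_fun setT g.
Proof. by move=> [_ g_ni _]; exact: nonincreasing_measurable. Qed.

Lemma loss_function_shift (R : realType) (g : R -> R) (c : R) :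
  loss_function g -> loss_function (fun x => g (x + c)).
Proof.
move=> [gc gni g0]; split=> // [t x y t01|x y xy]; last by rewrite gni// lerD2r.
rewrite (_ : _ + c = t * (x + c) + (1 - t) * (y + c)); last by ring.
exact: gc.
Qed.

(* Capping [phi] at [n] turns it into the bounded-below loss [n - min phi n]. *)
Lemma loss_function_cap (R : realType) (phi : R -> R) (n : R) :
  concave_function phi -> nondecreasing_fun phi ->
  loss_function (fun x => n - Num.min (phi x) n).
Proof.
move=> phic phid; split=> [t x y /andP[t0 t1]|x y xy|x].
- have phit : t * phi x + (1 - t) * phi y <= phi (t * x + (1 - t) * y).
    have := phic (Itv01 t0 t1) x y; rewrite !inE => /(_ I I).
    by rewrite !convRE /= /unstable.onem; lra.
  have h1 : t * Num.min (phi x) n <= t * phi x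
    by rewrite ler_wpM2l// ge_min lexx.
  have h2 : t * Num.min (phi x) n <= t * n
    by rewrite ler_wpM2l// ge_min lexx orbT.
  have t1' : 0 <= 1 - t by rewrite subr_ge0.
  have h3 : (1 - t) * Num.min (phi y) n <= (1 - t) * phi y
    by rewrite ler_wpM2l// ge_min lexx.
  have h4 : (1 - t) * Num.min (phi y) n <= (1 - t) * n
    by rewrite ler_wpM2l// ge_min lexx orbT.
  have : t * Num.min (phi x) n + (1 - t) * Num.min (phi y) n <=
         Num.min (phi (t * x + (1 - t) * y)) n by rewrite le_min; apply/andP;
           split; lra.
  by lra.
- by rewrite lerD2l lerN2 le_min2// phid.
- by rewrite subr_ge0 ge_min lexx orbT.
Qed.

Section ssd_of_losses.
Context d (T : measurableType d) (R : realType) (P : probability T R).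
Variables (U V : {mfun T >-> R}).
Hypothesis UV : forall g, loss_function g ->
  (\int[P]_w (g (U w))%:E <= \int[P]_w (g (V w))%:E)%E.

(** The capped losses give [E phi(U)^- + E min(phi(V)^+, n) <= E phi(V)^- + E min(phi(U)^+, n)], an
    inequality between sums of nonnegative terms. Monotone convergence yields [S], and terms are
    moved across only at the end, where the expectations are known to be defined. *)
Lemma ssd_ge_loss : ssd_ge P U V.
Proof.
move=> phi phic phid.
have mphi : measurable_fun setT phi by exact: nondecreasing_measurable.
have mp (W : {mfun T >-> R}) : measurable_fun setT (phi \o W)^\+%R.
  by apply: measurable_funrpos; exact: measurableT_comp.
have mn (W : {mfun T >-> R}) : measurable_fun setT (phi \o W)^\-%R.
  by apply: measurable_funrneg; exact: measurableT_comp.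
pose cap n (W : {mfun T >-> R}) x := Num.min ((phi \o W)^\+%R x) n%:R.
have mcap n W : measurable_fun setT (cap n W).
  by apply: measurable_minr.
have cap0 n W x : 0 <= cap n W x by rewrite le_min funrpos_ge0 ler0n.
pose I (f : T -> R) := (\int[P]_w (f w)%:E)%E.
have ID (f g : T -> R) : measurable_fun setT f -> measurable_fun setT g ->
    (forall x, 0 <= f x) -> (forall x, 0 <= g x) -> I (f \+ g) = (I f + I g)%E.
  move=> mf mg f0 g0; rewrite /I -ge0_integralD//.
  - by move=> x _; rewrite lee_fin.
  - exact/measurable_EFinP.
  - by move=> x _; rewrite lee_fin.
  - exact/measurable_EFinP.
have step n : (I ((phi \o U)^\- \+ cap n V)%R <= I ((phi \o V)^\- \+ cap n
  U)%R)%E.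
  pose g x := n%:R - Num.min (phi x) n%:R.
  have lg : loss_function g by exact: loss_function_cap.
  have mg (W : {mfun T >-> R}) : measurable_fun setT (g \o W).
    by apply: measurableT_comp => //; exact: measurable_loss.
  have g0 (W : {mfun T >-> R}) x : 0 <= (g \o W) x by case: lg => _ _; exact.
  have Icst : I (cst n%:R) = n%:R%:E by exact: (integral_prob_cst P n%:R%:E).
  (* Integrates the pointwise identity [n - min(phi, n) + min(phi^+, n) = n + phi^-]. *)
  have gE (W : {mfun T >-> R}) : (I (g \o W) + I (cap n W) = n%:R%:E + I (phi
    \o W)^\-%R)%E.
    rewrite -Icst -!ID//.
    apply: eq_integral => x _; congr EFin.
    rewrite /g /cap /funrpos /funrneg /=.
    have n0 : 0 <= n%:R :> R by [].
    by rewrite /Order.max /Order.min; do ![case: ifPn]; rewrite -?leNgt; lra.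
  rewrite (ID _ (cap n V))// (ID _ (cap n U))//.
  have : (I (g \o U) <= I (g \o V))%E by exact: UV.
  move: (gE U) (gE V); move: (I (g \o U)) (I (g \o V)) (I (cap n U)) (I (cap n
    V))
    (I (phi \o U)^\-%R) (I (phi \o V)^\-%R) => a b c e f h EU EV ab.
  by rewrite -(@leeD2lE _ n%:R%:E)// !addeA -EU -EV [leRHS]addeAC leeD2r//
    leeD2r.
have S : (I (phi \o U)^\-%R + I (phi \o V)^\+%R <= I (phi \o V)^\-%R + I (phi
  \o U)^\+%R)%E.
  have lim n : (I ((phi \o U)^\- \+ cap n V)%R <= I (phi \o V)^\-%R + I (phi \o
    U)^\+%R)%E.
    apply: le_trans (step n) _; rewrite ID// leeD2l//.
    apply: ge0_le_integral => //.
    - by move=> x _; rewrite lee_fin.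
    - exact/measurable_EFinP.
    - exact/measurable_EFinP.
    - by move=> x _; rewrite lee_fin ge_min lexx.
  rewrite -ID//.
  pose f n x := (((phi \o U)^\- \+ cap n V)%R x)%:E.
  have mf n : measurable_fun setT (f n) by apply/measurable_EFinP;
    exact: measurable_funD.
  have f0 n x : (0 <= f n x)%E by rewrite lee_fin addr_ge0.
  have nd x : {homo f^~ x : n m / (n <= m)%N >-> (n <= m)%E}.
    by move=> n m nm; rewrite lee_fin lerD2l le_min2// ler_nat.
  have cvgf x : f ^~ x @ \oo --> (((phi \o U)^\- \+ (phi \o V)^\+)%R x)%:E.
    apply: cvg_near_cst; near=> n; congr (_ + _)%:E; apply/min_idPl.
    by apply: le_trans (ltW (truncnS_gt _)) _; rewrite ler_nat; near: n;
      exact: nbhs_infty_ge.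
  rewrite (_ : I _ = \int[P]_x limn (f^~ x))%E; last first.
    by apply: eq_integral => x _; apply/esym/cvg_lim.
  rewrite monotone_convergence//.
  apply: lime_le; last by apply: nearW => n; exact: lim.
  apply: ereal_nondecreasing_is_cvgn => n m nm.
  by apply: ge0_le_integral => // x _; exact: nd.
rewrite /expectation_defined !unlock => dU dV.
rewrite integralE [leRHS]integralE !funerpos !funerneg.
move: S dU dV; rewrite /I.
have p0 (W : T -> R) : (0 <= \int[P]_w ((phi \o W)^\+ w)%:E)%E
  by apply: integral_ge0 => x _; rewrite lee_fin.
have n0 (W : T -> R) : (0 <= \int[P]_w ((phi \o W)^\- w)%:E)%E
  by apply: integral_ge0 => x _; rewrite lee_fin.
move: (p0 U) (p0 V) (n0 U) (n0 V).
rewrite /=.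
(* Each integral is finite or [+oo]. Combinations excluded by [S] or by the definedness assumptions
   are discarded; in the goals left, all four are finite, or the left side is [-oo], or the right
   side is [+oo]. *)
case: (\int[P]_w ((phi \o U)^\+ w)%:E)%E => [pu| |]//;
case: (\int[P]_w ((phi \o V)^\+ w)%:E)%E => [pv| |]//;
case: (\int[P]_w ((phi \o U)^\- w)%:E)%E => [nu| |]//;
case: (\int[P]_w ((phi \o V)^\- w)%:E)%E => [nv| |]//=.
all: try by move=> _ _ _ _ _ [] + [].
- by move=> _ _ _ _ + _ _; rewrite -!EFinD !lee_fin; lra.
- by move=> *; rewrite addeNy leNye.
- by move=> *; rewrite addye// leey.
Unshelve. all: by end_near. Qed.

End ssd_of_losses.

(** * Distinctness of the laws *)

Section cosine.
Variable R : realType.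
Implicit Types x y : R.

Lemma one_sub_cos x : 1 - cos x = 2 * sin (x / 2) ^+ 2.
Proof.
have -> : cos x = cos ((x / 2) *+ 2) by congr cos; rewrite -mulr_natr; field.
by rewrite cos_mulr2n cos2sin2; ring.
Qed.

Lemma sin_near_id x : exists2 t : R, `|t| <= `|x| & sin x = cos t * x.
Proof. by have [t [tx _] E] := mvt0 x (@is_derive_sin R) (sin0 _); exists t.
  Qed.

Lemma sqr_sin_le x : sin x ^+ 2 <= x ^+ 2.
Proof.
have [t _ ->] := sin_near_id x; by rewrite exprMn ler_piMl
  ?sqr_ge0// cos2sin2 gerBl sqr_ge0.
Qed.

Lemma one_sub_cos_le x : 1 - cos x <= x ^+ 2 / 2.
Proof. by rewrite one_sub_cos; have := sqr_sin_le (x / 2); nra. Qed.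

(** With [sin (x / 2) = cos t * (x / 2)] and [|t| <= |x / 2|], the deviation of [cos t ^ 2] from 1
    is [sin t ^ 2], at most [x^2 / 4]. *)
Lemma one_sub_cos_ge x : x ^+ 2 / 2 - x ^+ 4 / 4 <= 1 - cos x.
Proof.
rewrite one_sub_cos; have [t tx ->] := sin_near_id (x / 2).
have t2 : t ^+ 2 <= x ^+ 2 / 4.
  rewrite -(real_normK (num_real t)).
  have -> : x ^+ 2 / 4 = `|x / 2| ^+ 2 by rewrite real_normK
    ?num_real// exprMn; field.
  by rewrite lerXn2r ?nnegrE.
rewrite exprMn cos2sin2; have := sqr_sin_le t.
have x2 := sqr_ge0 x.
have -> : x ^+ 4 = x ^+ 2 * x ^+ 2 by ring.
have -> : (x / 2) ^+ 2 = x ^+ 2 / 4 by rewrite exprMn; field.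
move: t2 x2; move: (x ^+ 2) (t ^+ 2) (sin t ^+ 2) => a b c; nra.
Qed.

End cosine.

(** * Characteristic functions at small frequencies *)

Section law_of_sum.
Context d (T : measurableType d) (R : realType) (P : probability T R).
Implicit Types X Y V : {mfun T >-> R}.

(** The second moment is read off the real part of the characteristic function near 0: the integrand
    tends to [X^2] and is dominated by it. *)
Lemma cvg_second_moment X : (\int[P]_w ((X w) ^+ 2)%:E < +oo)%E ->
  (\int[P]_w (2 * n.+1%:R ^+ 2 * (1 - cos (X w / n.+1%:R)))%:E)%E @[n -->
    \oo] -->
  (\int[P]_w ((X w) ^+ 2)%:E)%E.
Proof.
move=> X2.
pose f n w := (2 * n.+1%:R ^+ 2 * (1 - cos (X w / n.+1%:R)))%:E.
pose g w := ((X w) ^+ 2)%:E.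
have mg : measurable_fun setT g.
  by apply/measurable_EFinP; apply: measurable_funX.
have mf n : measurable_fun setT (f n).
  apply/measurable_EFinP; apply: measurable_funM => //;
    apply: measurable_funB => //.
  apply: measurableT_comp; last exact: measurable_funM.
  by apply: continuous_measurable_fun; exact: continuous_cos.
have f_ub n w : 2 * n.+1%:R ^+ 2 * (1 - cos (X w / n.+1%:R)) <= X w ^+ 2.
  have := one_sub_cos_le (X w / n.+1%:R);
    rewrite -(@ler_pM2l _ (2 * n.+1%:R ^+ 2)) ?mulr_gt0//.
  by move=> /le_trans; apply; rewrite le_eqVlt; apply/orP; left; apply/eqP;
    field.
have f_lb n w : X w ^+ 2 - X w ^+ 4 / 2 * n.+1%:R^-1 <= 2 * n.+1%:R ^+ 2 * (1 -
  cos (X w / n.+1%:R)).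
  have := one_sub_cos_ge (X w / n.+1%:R);
    rewrite -(@ler_pM2l _ (2 * n.+1%:R ^+ 2)) ?mulr_gt0//.
  apply: le_trans.
  have -> : 2 * n.+1%:R ^+ 2 * ((X w / n.+1%:R) ^+ 2 / 2 - (X w / n.+1%:R) ^+ 4
    / 4) =
      X w ^+ 2 - X w ^+ 4 / 2 * n.+1%:R^-1 * n.+1%:R^-1 by field.
  rewrite lerD2l lerN2 ler_piMr ?invf_le1 ?ler1n//.
  by rewrite mulr_ge0 ?invr_ge0// divr_ge0// exprn_even_ge0.
have f_ge0 n w : 0 <= 2 * n.+1%:R ^+ 2 * (1 - cos (X w / n.+1%:R)).
  by rewrite mulr_ge0// ?mulr_ge0// subr_ge0 cos_le1.
have ig : P.-integrable setT g.
  apply/integrableP; split => //.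
  by under eq_integral do rewrite gee0_abs ?lee_fin ?sqr_ge0//.
have [||_ _ /=] := @dominated_convergence _ _ _ P setT measurableT f g g mf mg
  _ ig.
- apply: aeW => w _; apply: cvg_EFin; first exact: nearW.
  have cl : X w ^+ 2 - X w ^+ 4 / 2 * n.+1%:R^-1 @[n --> \oo] --> X w ^+ 2.
    rewrite -[X in _ --> X]subr0 -(mulr0 (X w ^+ 4 / 2)).
    apply: cvgB; first exact: cvg_cst.
    by apply: cvgM; [exact: cvg_cst|exact: cvg_harmonic].
  apply: (squeeze_cvgr _ cl (cvg_cst _)); apply: nearW => n.
  by rewrite f_lb f_ub.
- by apply: aeW => w n _; rewrite gee0_abs lee_fin.
- exact.
Qed.

(** Continuity at 0 of the real part of the characteristic function, which is therefore nonzero at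
    small frequencies. *)
Lemma cvg_integral_cos V :
  (\int[P]_w (cos (V w / n.+1%:R))%:E)%E @[n --> \oo] --> 1%E.
Proof.
pose f n w := (cos (V w / n.+1%:R))%:E.
have mf n : measurable_fun setT (f n).
  apply/measurable_EFinP; apply: measurableT_comp; last exact: measurable_funM.
  by apply: continuous_measurable_fun; exact: continuous_cos.
have mc : measurable_fun setT (cst 1%E : T -> \bar R) by exact: measurable_cst.
have ic : P.-integrable setT (cst 1%E : T -> \bar R).
  by apply: (@bounded_prob_integrable _ _ _ P (cst 1) 1) => // x;
    rewrite normr1.
have [||_ _ /=] := @dominated_convergence _ _ _ P setT measurableT f (cst 1%E)
  (cst 1%E) mf mc _ ic.
- apply: aeW => w _; apply: cvg_EFin; first exact: nearW.
  have cl : 1 - V w ^+ 2 / 2 * n.+1%:R^-1 @[n --> \oo] --> (1 : R).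
    rewrite -[X in _ --> X]subr0 -(mulr0 (V w ^+ 2 / 2)).
    apply: cvgB; first exact: cvg_cst.
    by apply: cvgM; [exact: cvg_cst|exact: cvg_harmonic].
  apply: (squeeze_cvgr _ cl (cvg_cst _)); apply: nearW => n.
  rewrite cos_le1 andbT.
  have := one_sub_cos_le (V w / n.+1%:R).
  have -> : (V w / n.+1%:R) ^+ 2 / 2 = V w ^+ 2 / 2 * n.+1%:R^-1 * n.+1%:R^-1
    by field.
  have : V w ^+ 2 / 2 * n.+1%:R^-1 * n.+1%:R^-1 <= V w ^+ 2 / 2 * n.+1%:R^-1.
    by rewrite ler_piMr ?invf_le1 ?ler1n// mulr_ge0
      ?invr_ge0// divr_ge0// sqr_ge0.
  by move=> BA cB; rewrite lerBlDr -lerBlDl; exact: le_trans cB BA.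
- by apply: aeW => w n _; rewrite lee_fin cos_max.
- by rewrite (integral_prob_cst P 1%E).
Qed.

Lemma same_law_integral X Y (f : R -> R) (C : R) : same_law P X Y ->
  measurable_fun setT f -> (forall x, `|f x| <= C) ->
  (\int[P]_w (f (X w))%:E = \int[P]_w (f (Y w))%:E)%E.
Proof.
move=> XY mf fC.
have mfE : measurable_fun setT (EFin \o f) by apply/measurable_EFinP.
have i (W : {mfun T >-> R}) : P.-integrable setT (EFin \o f \o W).
  by apply: (@bounded_prob_integrable _ _ _ P (f \o W) C) => [|w /=];
    [exact: measurableT_comp|exact: fC].
have E (W : {mfun T >-> R}) :
    (\int[P]_w (f (W w))%:E = \int[distribution P W]_x (f x)%:E)%E.
  by rewrite (integral_distribution (f := EFin \o f)).
by rewrite !E; apply: eq_measure_integral => A mA _; exact: XY.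
Qed.

(** By independence the characteristic function of [V] factors out, and it is nonzero near 0; those
    of [X] and [Y] thus have the same real part there, and [cvg_second_moment] concludes. Complex
    values are kept as pairs [c], [s] of real integrals. *)
Lemma same_law_add_second_moment X Y V :
  independent P V X -> independent P V Y -> same_law P (X \+ V) (Y \+ V) ->
  (\int[P]_w ((X w) ^+ 2)%:E < +oo)%E -> (\int[P]_w ((Y w) ^+ 2)%:E < +oo)%E ->
  (\int[P]_w ((X w) ^+ 2)%:E = \int[P]_w ((Y w) ^+ 2)%:E)%E.
Proof.
move=> VX VY XYV X2 Y2.
have mS n : measurable_fun setT (fun x : R => sin (x / n.+1%:R)).
  apply: (measurableT_comp (f := @sin R)); last exact: measurable_funM.
  by apply: continuous_measurable_fun; exact: continuous_sin.
have mC n : measurable_fun setT (fun x : R => cos (x / n.+1%:R)).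
  apply: (measurableT_comp (f := @cos R)); last exact: measurable_funM.
  by apply: continuous_measurable_fun; exact: continuous_cos.
pose c (W : T -> R) n := fine (\int[P]_w (cos (W w / n.+1%:R))%:E)%E.
pose s (W : T -> R) n := fine (\int[P]_w (sin (W w / n.+1%:R))%:E)%E.
have iC (W : {mfun T >-> R}) n : P.-integrable setT (fun w => (cos (W w /
  n.+1%:R))%:E).
  apply: (@bounded_prob_integrable _ _ _ P (fun w => cos (W w / n.+1%:R)) 1).
    exact: (measurableT_comp (mC n)).
  by move=> w; exact: cos_max.
have iS (W : {mfun T >-> R}) n : P.-integrable setT (fun w => (sin (W w /
  n.+1%:R))%:E).
  apply: (@bounded_prob_integrable _ _ _ P (fun w => sin (W w / n.+1%:R)) 1).
    exact: (measurableT_comp (mS n)).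
  by move=> w; exact: sin_max.
have cE (W : {mfun T >-> R}) n : (\int[P]_w (cos (W w / n.+1%:R))%:E = (c W
  n)%:E)%E.
  by rewrite fineK// integrable_fin_num.
have sE (W : {mfun T >-> R}) n : (\int[P]_w (sin (W w / n.+1%:R))%:E = (s W
  n)%:E)%E.
  by rewrite fineK// integrable_fin_num.
have ib (W : {mfun T >-> R}) (f g : R -> R) : measurable_fun setT f ->
  measurable_fun setT g ->
    (forall x, `|f x| <= 1) -> (forall x, `|g x| <= 1) ->
    P.-integrable setT (EFin \o (fun w => f (V w) * g (W w))).
  move=> mf mg f1 g1; apply: (@bounded_prob_integrable _ _ _ P _ 1).
    by apply: measurable_funM; exact: measurableT_comp.
  by move=> w; rewrite normrM mulr_ile1.
have cD (W : {mfun T >-> R}) n : independent P V W ->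
    (\int[P]_w (cos ((W \+ V) w / n.+1%:R))%:E = (c V n * c W n - s V n * s W
      n)%:E)%E.
  move=> VW.
  rewrite EFinB !EFinM -!cE -!sE.
  rewrite -(integral_independentM VW (mC n) (mC n) (M := 1)); try by move=> x;
    exact: cos_max.
  rewrite -(integral_independentM VW (mS n) (mS n) (M := 1)); try by move=> x;
    exact: sin_max.
  rewrite -integralB_EFin//; last 2 first.
  - exact: (ib W _ _ (mC n) (mC n) (fun x => cos_max _) (fun x => cos_max _)).
  - exact: (ib W _ _ (mS n) (mS n) (fun x => sin_max _) (fun x => sin_max _)).
  by apply: eq_integral => w _ /=; rewrite -EFinB addrC mulrDl cosD.
have sD (W : {mfun T >-> R}) n : independent P V W ->
    (\int[P]_w (sin ((W \+ V) w / n.+1%:R))%:E = (s V n * c W n + c V n * s W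
      n)%:E)%E.
  move=> VW.
  rewrite EFinD !EFinM -!cE -!sE.
  rewrite -(integral_independentM VW (mS n) (mC n) (M := 1));
    try by (move=> x; (exact: cos_max || exact: sin_max)).
  rewrite -(integral_independentM VW (mC n) (mS n) (M := 1));
    try by (move=> x; (exact: cos_max || exact: sin_max)).
  rewrite -integralD_EFin//; last 2 first.
  - exact: (ib W _ _ (mS n) (mC n) (fun x => sin_max _) (fun x => cos_max _)).
  - exact: (ib W _ _ (mC n) (mS n) (fun x => cos_max _) (fun x => sin_max _)).
  by apply: eq_integral => w _ /=; rewrite -EFinD addrC mulrDl sinD.
have cXY n : c V n != 0 -> c X n = c Y n.
  move=> cV0.
  have E1 : c V n * c X n - s V n * s X n = c V n * c Y n - s V n * s Y n.
    apply: EFin_inj; rewrite -!cD//.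
    exact: (@same_law_integral (X \+ V) (Y \+ V) _ 1 XYV (mC n) (fun x =>
      cos_max _)).
  have E2 : s V n * c X n + c V n * s X n = s V n * c Y n + c V n * s Y n.
    apply: EFin_inj; rewrite -!sD//.
    exact: (@same_law_integral (X \+ V) (Y \+ V) _ 1 XYV (mS n) (fun x =>
      sin_max _)).
  (* Multiplication by the complex conjugate of the characteristic function of [V], keeping the real
     part. *)
  have : (c V n ^+ 2 + s V n ^+ 2) * (c X n - c Y n) = 0.
    rewrite (_ : _ * _ = c V n * ((c V n * c X n - s V n * s X n) - (c V n * c
      Y n - s V n * s Y n)) +
      s V n * ((s V n * c X n + c V n * s X n) - (s V n * c Y n + c V n * s Y
        n))); last by ring.
    by rewrite E1 E2 !subrr !mulr0 addr0.
  move/eqP; rewrite mulf_eq0 subr_eq0 => /orP[|/eqP//].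
  by rewrite paddr_eq0 ?sqr_ge0// sqrf_eq0 (negbTE cV0).
have E (W : {mfun T >-> R}) n :
    (\int[P]_w (2 * n.+1%:R ^+ 2 * (1 - cos (W w / n.+1%:R)))%:E =
     (2 * n.+1%:R ^+ 2 * (1 - c W n))%:E)%E.
  under eq_integral do rewrite EFinM EFinB.
  have i1 : P.-integrable setT (fun=> 1%E).
    by apply: (@bounded_prob_integrable _ _ _ P (cst 1) 1) => // x;
      rewrite normr1.
  rewrite integralZl//; last exact: integrableB.
  by rewrite integralB// (integral_prob_cst P 1%E) cE.
have cX := cvg_second_moment X2; have cY := cvg_second_moment Y2.
have c1 : c V n @[n --> \oo] --> (1 : R) by
  exact: fine_cvg (@cvg_integral_cos V).
apply: (cvg_unique (@ereal_hausdorff R) cX).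
apply: cvg_trans cY; apply: near_eq_cvg; near=> n.
rewrite !E cXY// gt_eqF//; near: n.
exact: (cvgr_gt _ c1 0 ltr01).
Unshelve. all: by end_near. Qed.

End law_of_sum.

(** * Noise with finite moments *)

Section sum_law.
Context (R : realType) (q1 q2 q3 : probability (measurableTypeR R) R).

Definition sum3 (z : measurableTypeR R * (measurableTypeR R * measurableTypeR
  R)) : R :=
  z.1 + z.2.1 + z.2.2.

Let measurable_sum3 : measurable_fun setT sum3.
Proof.
have m1 : measurable_fun setT (fun z : measurableTypeR R * (measurableTypeR R *
  measurableTypeR R) => z.1 : R).
  exact: (@measurable_fst _ _ (measurableTypeR R) _).
have m2 : measurable_fun setT (fun z : measurableTypeR R * (measurableTypeR R *
  measurableTypeR R) => z.2.1 : R).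
  exact: (measurableT_comp (@measurable_fst _ _ (measurableTypeR R)
    (measurableTypeR R)) measurable_snd).
have m3 : measurable_fun setT (fun z : measurableTypeR R * (measurableTypeR R *
  measurableTypeR R) => z.2.2 : R).
  exact: (measurableT_comp (@measurable_snd _ _ (measurableTypeR R)
    (measurableTypeR R)) measurable_snd).
by apply: measurable_funD => //; exact: measurable_funD.
Qed.

HB.instance Definition _ := isMeasurableFun.Build _ _ _ _ sum3 measurable_sum3.

Let q23 : probability (measurableTypeR R * measurableTypeR R)%type R :=
  (q2 \x q3)%E.

(** The convolution of the three laws. *)
Definition sum_law : probability R R := distribution (q1 \x q23)%E sum3.

Lemma integral_sum_law (f : R -> \bar R) : measurable_fun setT f ->
  (forall x, 0 <= f x)%E ->
  (\int[sum_law]_x f x = \int[q1]_v \int[q2]_u \int[q3]_z f (v + u + z)%R)%E.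
Proof.
move=> mf f0; have mfs := measurableT_comp mf measurable_sum3.
rewrite /sum_law ge0_integral_distribution//.
rewrite (fubini_tonelli1 (f \o sum3))//.
apply: eq_integral => v _; rewrite /fubini_F.
rewrite (fubini_tonelli1 (fun y => (f \o sum3) (v, y)))//.
- by apply: (measurableT_comp mfs); exact: measurable_pair1.
- by move=> z; exact: f0.
- by move=> z; exact: f0.
Qed.

(** From [|x + y + z| <= (1 + |x|) (1 + |y|) (1 + |z|)], the moment is bounded by a product of three
    finite integrals. *)
Lemma sum_law_moment n :
  (\int[q1]_x ((1 + `|x : R|) ^+ n)%:E < +oo)%E ->
  (\int[q2]_x ((1 + `|x : R|) ^+ n)%:E < +oo)%E ->
  (\int[q3]_x ((1 + `|x : R|) ^+ n)%:E < +oo)%E ->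
  (\int[sum_law]_x (`|x| ^+ n)%:E < +oo)%E.
Proof.
move=> f1 f2 f3.
have mX : measurable_fun setT (fun x : R => (`|x| ^+ n)%:E).
  by apply/measurable_EFinP; exact: measurable_funX.
pose A (x : R) : R := (1 + `|x|) ^+ n.
have mA : measurable_fun setT A by apply: measurable_funX;
  exact: measurable_funD.
have A0 x : 0 <= A x by rewrite exprn_ge0 ?addr_ge0.
have mAE : measurable_fun setT (fun x : measurableTypeR R => (A x)%:E).
  by apply/measurable_EFinP.
pose B := fun z : measurableTypeR R * (measurableTypeR R * measurableTypeR R) =>
  ((A z.1)%:E * ((A z.2.1)%:E * (A z.2.2)%:E))%E.
pose B2 := fun z : measurableTypeR R * measurableTypeR R => ((A z.1)%:E * (A
  z.2)%:E)%E.
have mB2 : measurable_fun setT B2.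
  by apply: emeasurable_funM;
    [exact: (measurableT_comp mAE measurable_fst)|exact: (measurableT_comp mAE
      measurable_snd)].
have mB : measurable_fun setT B.
  by apply: emeasurable_funM;
    [exact: (measurableT_comp mAE measurable_fst)|exact: (measurableT_comp mB2
      measurable_snd)].
have B20 z : (0 <= B2 z)%E by rewrite mule_ge0// lee_fin.
have B0 z : (0 <= B z)%E by apply: mule_ge0; [rewrite lee_fin|exact: B20].
rewrite /sum_law ge0_integral_distribution//.
apply: (@le_lt_trans _ _ (\int[q1 \x q23]_z B z)%E).
  apply: ge0_le_integral => //.
  - by move=> z _; rewrite lee_fin.
  - exact: (measurableT_comp mX measurable_sum3).
  - move=> z _; rewrite /B -!EFinM lee_fin /A -!exprMn lerXn2r ?nnegrE
      ?mulr_ge0 ?addr_ge0//.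
    have := ler_normD (z.1 + z.2.1) z.2.2; have := ler_normD z.1 z.2.1.
    rewrite /sum3 /=; move: (normr_ge0 z.1) (normr_ge0 z.2.1) (normr_ge0 z.2.2).
    move: `|z.1| `|z.2.1| `|z.2.2| `|z.1 + z.2.1| `|_ + _| => s t r st str s0
      t0 r0.
    have st0 := mulr_ge0 s0 t0; have tr0 := mulr_ge0 t0 r0; have sr0 :=
      mulr_ge0 s0 r0.
    have str0 := mulr_ge0 s0 tr0.
    have -> : (1 + s) * ((1 + t) * (1 + r)) = 1 + s + t + r + s * t + t * r + s
      * r + s * (t * r).
      by ring.
    by lra.
have AE0 (x : R) : (0 <= (A x)%:E)%E by rewrite lee_fin.
have step d' (T' : measurableType d') (q : probability T' R)
    (h : T' -> \bar R) (p : probability (measurableTypeR R) R) :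
    measurable_fun setT h -> (forall x, 0 <= h x)%E ->
    (\int[q]_x h x < +oo)%E -> (\int[p]_x (A x)%:E < +oo)%E ->
    (\int[p]_x \int[q]_y ((A x)%:E * h y) < +oo)%E.
  move=> mh hn hoo Aoo.
  rewrite [ltLHS](_ : _ = \int[p]_x ((A x)%:E * \int[q]_y h y))%E; last first.
    apply: eq_integral.
    by move=> x _; rewrite ge0_integralZl.
  have h0 : (0 <= \int[q]_y h y)%E by exact: integral_ge0.
  rewrite ge0_integralZr//.
  by rewrite lte_mul_pinfty ?integral_ge0// ge0_fin_numE ?integral_ge0.
have E2 : (\int[q23]_z B2 z < +oo)%E.
  rewrite (fubini_tonelli1 B2)//.
  exact: (step _ _ q3 (fun x => (A x)%:E) q2 mAE AE0 f3 f2).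
rewrite (fubini_tonelli1 B)//.
exact: (step _ _ q23 B2 q1 mB2 B20 E2 f1).
Qed.

End sum_law.

Lemma uniform_moment (R : realType) n :
  (\int[uniform_prob (@ltr01 R)]_x ((1 + `|x : R|) ^+ n)%:E < +oo)%E.
Proof.
have mA : measurable_fun setT (fun x : measurableTypeR R => ((1 + `|x : R|) ^+
  n)%:E).
  by apply/measurable_EFinP; apply: measurable_funX; exact: measurable_funD.
rewrite integral_uniform//.
rewrite subr0 invr1 mul1e.
apply: (@le_lt_trans _ _ (\int[lebesgue_measure]_(x in `[0%R, 1%R]) (cst (2 ^+
  n)%:E x))%E).
  apply: ge0_le_integral => //.
  - exact: measurable_funTS.
  - move=> x; rewrite /= in_itv/= => /andP[x0 x1].
    by rewrite lee_fin lerXn2r ?nnegrE ?addr_ge0// ger0_norm//; lra.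
by rewrite integral_cst//= lebesgue_measure_itv/= lte_fin ltr01 -EFinB -EFinM
  ltry.
Qed.

(** * Existence of a noise with all moments *)

Section good_law.
Context (R : realType) (a b : probability R R).

(** Stated for laws, so that it transfers to every enlargement and survives convolution with further
    noise. *)
Definition loss_dominated (nu : probability R R) := forall g, loss_function g ->
  (\int[nu]_z \int[a]_x (g (x + z))%:E <= \int[nu]_z \int[b]_x (g (x +
    z))%:E)%E.

Lemma exists_loss_dominated_moments :
  (forall n, \int[a]_x (`|x| ^+ n)%:E < +oo)%E ->
  (forall n, \int[b]_x (`|x| ^+ n)%:E < +oo)%E ->
  (\int[a]_x x%:E = \int[b]_x x%:E)%E ->
  (\int[a]_x (x ^+ 2)%:E < \int[b]_x (x ^+ 2)%:E)%E ->
  exists2 nu, loss_dominated nu & forall n, (\int[nu]_x (`|x| ^+ n)%:E < +oo)%E.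
Proof.
move=> am bm mean var.
pose S (c : probability R R) := fine (\int[c]_x (x ^+ 2)%:E)%E.
have x20 (c : probability R R) : (0 <= \int[c]_x (x ^+ 2)%:E)%E.
  by apply: integral_ge0 => x _; rewrite lee_fin sqr_ge0.
have SE (c : probability R R) : (forall n, \int[c]_x (`|x| ^+ n)%:E < +oo)%E ->
    (\int[c]_x (x ^+ 2)%:E = (S c)%:E)%E.
  move=> cm; rewrite fineK// ge0_fin_numE//.
  by under eq_integral do rewrite -(real_normK (num_real _)).
have i1 (c : probability R R) : (forall n, \int[c]_x (`|x| ^+ n)%:E < +oo)%E ->
    c.-integrable setT EFin.
  move=> cm; apply/integrableP; split; first exact/measurable_EFinP.
  by under eq_integral do rewrite abse_EFin -[`|_|]expr1.
(* This gap is the error granted to the weight: the weighted second moments then add up to at most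
   [S a + S b + (S b - S a) = 2 * S b]. *)
have eps0 : 0 < S b - S a by rewrite subr_gt0 -lte_fin -!SE.
have mX n : measurable_fun setT (fun x : R => (`|x| ^+ n)%:E).
  by apply/measurable_EFinP; exact: measurable_funX.
have abm n : (\int[measure_add a b]_x (`|x| ^+ n)%:E < +oo)%E.
  rewrite ge0_integral_measure_add//; first by rewrite lte_add_pinfty.
have [w [mw [w1 wE wD w_le] wpoly wint]] := exists_weight eps0 abm.
pose nu1 := harnack_law mw w1 wE wpoly.
have nu1_shift := harnack_law_shift mw w1 wE wD wpoly.
pose U : probability (measurableTypeR R) R := uniform_prob (@ltr01 R).
exists (sum_law U U nu1).
  move=> g lg; have mg := measurable_loss lg; case: lg => gc _ g0.
  have mgE (t : R) : measurable_fun setT (fun z : R => (g (t + z))%:E).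
    by apply/measurable_EFinP; apply: (measurableT_comp mg);
      exact: measurable_funD.
  (* Midpoint convexity between [x] and [x + 2]. *)
  have d2g x : 0 <= g (x + 1 + 1) - g (x + 1) *+ 2 + g x.
    have h01 : 0 <= (2^-1 : R) <= 1 by rewrite invr_ge0 ler0n invf_le1// ler1n.
    have := gc (2^-1) (x + 1 + 1) x h01.
    have -> : 2^-1 * (x + 1 + 1) + (1 - 2^-1) * x = x + 1 by field.
    by lra.
  have E (c : probability R R) :
      (\int[sum_law U U nu1]_z \int[c]_x (g (x + z))%:E = \int[c]_x smoothed
        nu1 g x)%E.
    pose F (y : R * R) : \bar R := (g (y.2 + y.1))%:E.
    have mF : measurable_fun setT F.
      apply/measurable_EFinP; apply: (measurableT_comp mg).
      by apply: measurable_funD; [exact: measurable_snd|exact: measurable_fst].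
    rewrite (fubini_tonelli (m1 := sum_law U U nu1) (m2 := c) F)//; last first.
      by move=> y; rewrite lee_fin.
    apply: eq_integral => x _.
    have gE0 z : (0 <= (g (x + z))%:E)%E by rewrite lee_fin.
    apply: etrans (integral_sum_law U U nu1 (mgE x) gE0) _.
    apply: eq_integral => v _; apply: eq_integral => u _;
      apply: eq_integral => z _.
    by rewrite !addrA.
  rewrite !E; apply: (le_integral_smoothed mw w1 wE w_le nu1_shift) => //.
  - exact: i1.
  - exact: i1.
  - have x2w0 x : (0 <= (x ^+ 2 * w x)%:E)%E.
      by rewrite lee_fin mulr_ge0 ?sqr_ge0// (le_trans ler01).
    have mx2w : measurable_fun setT (fun x : R => (x ^+ 2 * w x)%:E).
      by apply/measurable_EFinP; apply: measurable_funM => //;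
        exact: measurable_funX.
    have mx2 : measurable_fun setT (fun x : R => (x ^+ 2)%:E).
      by apply/measurable_EFinP; exact: measurable_funX.
    move: wint; rewrite !ge0_integral_measure_add//; try by move=> x _;
      rewrite lee_fin sqr_ge0.
    move=> /le_trans -> //; last by rewrite !SE// -!EFinD -EFinM lee_fin; lra.
    by rewrite SE// -EFinM ltry.
move=> n; apply: sum_law_moment; last exact: harnack_law_moment.
  exact: uniform_moment.
exact: uniform_moment.
Qed.
End good_law.

(** * Noise with infinite mean *)

Section heavy_law.
Context (R : realType).

Definition neg_inv_sqr (u : measurableTypeR R) : R := - powR u (- 2).

Let measurable_neg_inv_sqr : measurable_fun setT neg_inv_sqr.
Proof. by apply: measurableT_comp => //; exact: measurable_powR. Qed.

HB.instance Definition _ :=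
  isMeasurableFun.Build _ _ _ _ neg_inv_sqr measurable_neg_inv_sqr.

(* Its tail [P(z <= - t) = 1 / sqrt t] makes the negative part non-integrable.
  *)
Definition heavy_law : probability R R :=
  distribution (uniform_prob (@ltr01 R)) neg_inv_sqr.

(** The uniform variable lies in [[1 / (2 N), 1 / N]] with probability [1 / (2 N)], and there
    [- z >= N^2]; the contribution is at least [s (c + N^2) / (2 N)], which is unbounded in [N]. *)
Lemma integral_heavy_law_oo (h : R -> \bar R) (s c : R) :
  measurable_fun setT h -> (forall z, 0 <= h z)%E -> 0 < s ->
  (forall z, (s * (c - z))%:E <= h z)%E -> (\int[heavy_law]_z h z = +oo)%E.
Proof.
move=> mh h0 s0 hs; apply/eqyP => A A0.
(* Chosen so that [s / 2 * (c / N + N) >= A], using [c / N >= - |c|] for [N >= 1]. *)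
pose N := 1 + `|c| + 2 * A / s.
have As0 : 0 < 2 * A / s by rewrite divr_gt0// mulr_gt0.
have N1 : 1 <= N by rewrite /N -addrA lerDl addr_ge0// ltW.
have N0 : 0 < N by exact: lt_le_trans N1.
have cN : - N <= c.
  by have := lerNnormlW (lexx `|c|); rewrite /N; lra.
have K0 : 0 <= s * (c + N ^+ 2) by rewrite mulr_ge0 ?(ltW s0)//; nra.
have mhn := measurableT_comp mh measurable_neg_inv_sqr.
rewrite /heavy_law ge0_integral_distribution// integral_uniform//; last first.
  by move=> u; exact: h0.
rewrite subr0 invr1 mul1e.
pose I := `[(N^-1 / 2), N^-1]%classic : set (measurableTypeR R).
apply: (@le_trans _ _ (\int[lebesgue_measure]_(u in I) (h \o neg_inv_sqr)
  u)%E); last first.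
  apply: ge0_subset_integral => //.
  - exact: measurable_itv.
  - exact: measurable_funTS.
  - by move=> u _; exact: h0.
  move=> u; rewrite /I/= !in_itv/= => /andP[u1 u2]; apply/andP; split.
    by rewrite (le_trans _ u1)// divr_ge0// invr_ge0 ltW.
  by rewrite (le_trans u2)// invf_le1.
apply: (@le_trans _ _ (\int[lebesgue_measure]_(u in I) cst (s * (c + N ^+
  2))%:E u)%E); last first.
  apply: ge0_le_integral => //.
  - exact: measurable_itv.
  - exact: measurable_funTS.
  - move=> u; rewrite /I/= in_itv/= => /andP[u1 u2].
    apply: le_trans (hs _); rewrite lee_fin ler_wpM2l ?(ltW s0)// lerD2l.
    have u0 : 0 < u by apply: lt_le_trans u1; rewrite divr_gt0// invr_gt0.
    rewrite /neg_inv_sqr opprK powRN powR_mulrn ?(ltW u0)//.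
    rewrite -[leLHS]invrK lef_pV2 ?posrE ?invr_gt0 ?exprn_gt0// -exprVn.
    by rewrite lerXn2r ?nnegrE ?invr_ge0 ?(ltW u0) ?(ltW N0).
rewrite integral_cst//=; last exact: measurable_itv.
rewrite lebesgue_measure_itv/= lte_fin.
have NV : 0 < N^-1 by rewrite invr_gt0.
rewrite ifT; last by rewrite ltr_pdivrMr// ltr_pMr// ltr1n.
rewrite -EFinB -EFinM lee_fin.
rewrite (_ : s * (c + N ^+ 2) * (N^-1 - N^-1 / 2) = s / 2 * (c / N + N));
  last first.
  by field; rewrite gt_eqF.
have cNV : - `|c| <= c / N.
  rewrite ler_pdivlMr// (le_trans _ (lerNnormlW (lexx `|c|)))// mulNr lerN2.
  by rewrite ler_peMr.
have -> : A = s / 2 * (2 * A / s) by field; rewrite gt_eqF.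
by rewrite ler_wpM2l ?divr_ge0 ?(ltW s0)//; rewrite /N; move: cNV; rewrite /N;
  lra.
Qed.

(** A constant loss gives equality. A nonconstant one lies above a line of negative slope; as [b]
    has a mean, the line survives averaging over [b], and the heavy noise makes the right-hand side
    infinite. *)
Lemma loss_dominated_heavy (a b : probability R R) :
  b.-integrable setT EFin -> loss_dominated a b heavy_law.
Proof.
move=> ib g lg; have mg := measurable_loss lg; have [gc gni g0] := lg.
have [[x1 [x2 [x12 gx]]]|cstg] := pselect (exists x1 x2, x1 < x2 /\
  g x2 < g x1); last first.
  have gE x y : g x = g y.
    wlog xy : x y / x < y.
      by move=> h; have [/h|/h|->] := ltgtP x y.
    apply/eqP; rewrite eq_le (gni _ _ (ltW xy)) andbT leNgt.
    by apply/negP => gxy; apply: cstg; exists x, y.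
  rewrite le_eqVlt; apply/orP; left; apply/eqP; apply: eq_integral => z _.
  under eq_integral do rewrite (gE _ 0).
  under [RHS]eq_integral do rewrite (gE _ 0).
  by rewrite (integral_prob_cst a (g 0)%:E) (integral_prob_cst b (g 0)%:E).
(* [- s] is the slope of the chord of [g] over [[x1, x2]]. The line of that slope vanishing at [x1]
   lies below [g]: on the left by convexity, on the right because [g] is nonnegative. *)
pose s := (g x1 - g x2) / (x2 - x1).
have s0 : 0 < s by rewrite divr_gt0// subr_gt0.
have gs x : s * (x1 - x) <= g x.
  have [x1x|xx1] := leP x1 x.
    by rewrite (le_trans _ (g0 x))// mulr_ge0_le0 ?(ltW s0)// subr_le0.
  pose t := (x2 - x1) / (x2 - x).
  have x2x : 0 < x2 - x by rewrite subr_gt0 (lt_trans xx1).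
  have t01 : 0 <= t <= 1.
    rewrite /t divr_ge0 ?subr_ge0 ?(ltW x12) ?(ltW (lt_trans xx1 x12))//=.
    by rewrite ler_pdivrMr// mul1r lerD2l lerN2 ltW.
  have := gc t x x2 t01.
  rewrite (_ : t * x + (1 - t) * x2 = x1); last by rewrite /t; field;
    rewrite gt_eqF.
  move=> gx1; rewrite -subr_ge0 -(pmulr_rge0 _ (_ : 0 < t)); last first.
    by rewrite divr_gt0// subr_gt0.
  have E : t * (s * (x1 - x)) = (1 - t) * (g x1 - g x2).
    by rewrite /t /s; field; rewrite !gt_eqF// subr_gt0.
  have := g0 x2; nra.
suff -> : (\int[heavy_law]_z \int[b]_x (g (x + z))%:E = +oo)%E by rewrite leey.
pose m := fine (\int[b]_x x%:E)%E.
pose F (y : R * R) : \bar R := (g (y.2 + y.1))%:E.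
have mF : measurable_fun setT F.
  apply/measurable_EFinP; apply: (measurableT_comp mg).
  by apply: measurable_funD; [exact: measurable_snd|exact: measurable_fst].
apply: (@integral_heavy_law_oo _ s (x1 - m)) => //.
- by apply: (measurable_fun_fubini_tonelli_F F) => // y; rewrite lee_fin.
- by move=> z; apply: integral_ge0 => x _; rewrite lee_fin.
move=> z; have [goo|] := ltP (\int[b]_x (g (x + z))%:E)%E +oo%E; last first.
  by rewrite leye_eq => /eqP ->; rewrite leey.
have icst (r : R) : b.-integrable setT (fun=> r%:E).
  apply/integrableP; split; first exact: measurable_cst.
  by rewrite (integral_prob_cst b `|r%:E|%E) ltry.
have iz := integrableZl measurableT s ib.
have E : (\int[b]_x ((s * (x1 - z))%:E - s%:E * x%:E) = (s * (x1 - m -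
  z))%:E)%E.
  rewrite integralB// integralZl// (integral_prob_cst b (s * (x1 - z))%:E).
  rewrite -[(\int[b]_x x%:E)%E]fineK ?integrable_fin_num// -/m -EFinM -EFinB.
  by congr EFin; ring.
rewrite -E; apply: le_integral => //.
- exact: (integrableB measurableT (icst _) iz).
- apply/integrableP; split.
    by apply/measurable_EFinP; apply: (measurableT_comp mg);
      exact: measurable_funD.
  by under eq_integral do rewrite gee0_abs ?lee_fin//.
move=> x _; rewrite -EFinM -EFinB lee_fin; apply: le_trans (gs (x + z)).
by rewrite le_eqVlt; apply/orP; left; apply/eqP; ring.
Qed.

End heavy_law.

(** * The theorem *)

Lemma same_law_ge0_integral d (T : measurableType d) (R : realType)
    (P : probability T R) (a : probability R R) (X : {mfun T >-> R}) (f : R ->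
      \bar R) :
  (forall A, measurable A -> P (X @^-1` A) = a A) ->
  measurable_fun setT f -> (forall x, 0 <= f x)%E ->
  (\int[P]_w f (X w) = \int[a]_x f x)%E.
Proof.
move=> Xa mf f0; transitivity (\int[distribution P X]_x f x)%E.
  by rewrite ge0_integral_distribution.
by apply: eq_measure_integral => A mA _; exact: Xa.
Qed.

(** * Transfer to noisier noise *)

Section noise.
Context (R : realType) (a b nu : probability R R).
Context d (T : measurableType d) (P : probability T R).
Variables (X Y Z Z' : {mfun T >-> R}).
Hypotheses (Xa : forall A, measurable A -> P (X @^-1` A) = a A)
  (Yb : forall A, measurable A -> P (Y @^-1` A) = b A)
  (Znu : forall A, measurable A -> P (Z @^-1` A) = nu A)
  (Z'X : independent P Z' X) (Z'Y : independent P Z' Y)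
  (Z'Z : noisier P Z' Z).

(** For each value [v] of the additional noise, the translate of [g] by [v] is again a loss, to
    which [dom] applies; the inequality is then integrated over [v]. *)
Lemma le_integral_loss_noise g : loss_dominated a b nu -> loss_function g ->
  (\int[P]_w (g ((X \+ Z') w))%:E <= \int[P]_w (g ((Y \+ Z') w))%:E)%E.
Proof.
move=> dom lg; have mg := measurable_loss lg; have [_ _ g0] := lg.
have [W [WZ Z'E]] := Z'Z.
pose F (y : R * R) : \bar R := (g (y.2 + y.1))%:E.
have mF : measurable_fun setT F.
  apply/measurable_EFinP; apply: (measurableT_comp mg).
  by apply: measurable_funD; [exact: measurable_snd|exact: measurable_fst].
have F0 y : (0 <= F y)%E by rewrite lee_fin.
pose H (c : probability R R) v := (\int[c]_x F (v, x))%E.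
have mH c : measurable_fun setT (H c) by exact: measurable_fun_fubini_tonelli_F.
have H0 c v : (0 <= H c v)%E by apply: integral_ge0 => x _; exact: F0.
pose F2 c (y : R * R) := H c (y.2 + y.1).
have mF2 c : measurable_fun setT (F2 c).
  apply: (measurableT_comp (mH c)).
  by apply: measurable_funD; [exact: measurable_snd|exact: measurable_fst].
(* Integrating out [V] leaves an integral depending on the law of [Z'] alone, which is the
   convolution of the laws of [Z] and [W]. *)
have E (c : probability R R) (V : {mfun T >-> R}) :
    (forall A, measurable A -> P (V @^-1` A) = c A) -> independent P Z' V ->
    (\int[P]_w (g ((V \+ Z') w))%:E =
     \int[distribution P W]_v \int[nu]_u H c (u + v)%R)%E.
  move=> Vc Z'V.
  rewrite -[LHS]/(\int[P]_w F (Z' w, V w))%E (ge0_integral_independent Z'V)//.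
  transitivity (\int[distribution P Z']_v H c v)%E.
    apply: eq_integral => v _; apply: eq_measure_integral => A mA _; exact: Vc.
  rewrite ge0_integral_distribution//.
  transitivity (\int[P]_w F2 c (W w, Z w))%E.
    by apply: eq_integral => w _; rewrite /F2/= Z'E.
  rewrite (ge0_integral_independent WZ)//; last by move=> y; exact: H0.
  apply: eq_integral => v _; apply: eq_measure_integral => A mA _; exact: Znu.
rewrite [leLHS](E a X Xa Z'X) [leRHS](E b Y Yb Z'Y);
  apply: ge0_le_integral => //.
- by move=> v _; apply: integral_ge0 => u _; exact: H0.
- by apply: (measurable_fun_fubini_tonelli_F (F2 a)) => // y; exact: H0.
- by apply: (measurable_fun_fubini_tonelli_F (F2 b)) => // y; exact: H0.
move=> v _; have := dom _ (loss_function_shift v lg).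
rewrite /H /F/=.
by under eq_integral do under eq_integral do rewrite -addrA;
   under [leRHS]eq_integral do under eq_integral do rewrite -addrA.
Qed.

Lemma ssd_gt_noise : loss_dominated a b nu ->
  (\int[a]_x (x ^+ 2)%:E < \int[b]_x (x ^+ 2)%:E < +oo)%E ->
  ssd_gt P (X \+ Z') (Y \+ Z').
Proof.
move=> dom /andP[ab boo]; split.
  apply: (@ssd_ge_loss _ _ _ P (X \+ Z') (Y \+ Z')) => g lg.
  exact: le_integral_loss_noise.
have m2 : measurable_fun setT (fun x : R => (x ^+ 2)%:E).
  by apply/measurable_EFinP; exact: measurable_funX.
have p2 (x : R) : (0 <= (x ^+ 2)%:E)%E by rewrite lee_fin sqr_ge0.
have EX := same_law_ge0_integral Xa m2 p2.
have EY := same_law_ge0_integral Yb m2 p2.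
move=> /(same_law_add_second_moment Z'X Z'Y).
rewrite EX EY => /(_ (lt_trans ab boo) boo) eab.
by rewrite eab ltxx in ab.
Qed.

End noise.

(** * Finite variance and second moments *)

Section moments.
Context d (T : measurableType d) (R : realType) (P : probability T R).
Variable X : {mfun T >-> R}.

(** The variance is centred at [c], the [fine] part of the expectation, which is a real number in
    every case; [X^2 <= 2 (X - c)^2 + 2 c^2] then holds before integrability of [X] is known. *)
Lemma finite_variance_sqr : ('V_P[X] < +oo)%E ->
  (\int[P]_w (X w ^+ 2)%:E < +oo)%E.
Proof.
rewrite /variance !unlock /=; set c := fine _ => V.
have X2le w : X w ^+ 2 <= 2 * ((X w - c) * (X w - c)) + 2 * c ^+ 2.
  by have := sqr_ge0 (X w - c - c); nra.
have mc : measurable_fun setT (fun w => ((X w - c) * (X w - c))%:E).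
  by apply/measurable_EFinP; apply: measurable_funM; exact: measurable_funB.
have p0 w : (0 <= ((X w - c) * (X w - c))%:E)%E
  by rewrite lee_fin -expr2 sqr_ge0.
apply: (@le_lt_trans _ _ (\int[P]_w (2%:E * ((X w - c) * (X w - c))%:E + (cst
  (2 * c ^+ 2)%:E w)))%E).
  apply: ge0_le_integral => //.
  - by move=> w _; rewrite lee_fin sqr_ge0.
  - by apply/measurable_EFinP; exact: measurable_funX.
  - by apply: emeasurable_funD => //; exact: measurable_funeM.
  - by move=> w _; rewrite -EFinM -EFinD lee_fin X2le.
rewrite ge0_integralD//; last 3 first.
- by move=> w _; rewrite mule_ge0// lee_fin.
- exact: measurable_funeM.
- by move=> w _; rewrite lee_fin mulr_ge0 ?sqr_ge0.
rewrite ge0_integralZl//; first by rewrite integral_prob_cst lte_add_pinfty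
  ?ltry// lte_mul_pinfty.
Qed.

Lemma integrable_of_sqr : (\int[P]_w (X w ^+ 2)%:E < +oo)%E ->
  P.-integrable setT (EFin \o X).
Proof.
move=> X2; have i2 : P.-integrable setT (fun w => (X w ^+ 2)%:E).
  apply/integrableP; split; first by apply/measurable_EFinP;
    exact: measurable_funX.
  by under eq_integral do rewrite gee0_abs ?lee_fin ?sqr_ge0//.
have i1 : P.-integrable setT (EFin \o cst 1).
  by apply: (@bounded_prob_integrable _ _ _ P _ 1) => // x; rewrite normr1.
apply: (le_integrable measurableT _ _ (integrableD measurableT i1 i2)).
  exact/measurable_EFinP.
move=> w _; rewrite /= lee_fin [leRHS]ger0_norm ?addr_ge0 ?sqr_ge0//.
rewrite -(real_normK (num_real (X w))).
by have := sqr_ge0 (`|X w| - 1); have := normr_ge0 (X w); nra.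
Qed.

Lemma variance_sqr : (\int[P]_w (X w ^+ 2)%:E < +oo)%E ->
  ('V_P[X] = \int[P]_w (X w ^+ 2)%:E - ((fine 'E_P[X]) ^+ 2)%:E)%E.
Proof.
move=> X2; have i1 := integrable_of_sqr X2.
have i2 : P.-integrable setT (fun w => (X w ^+ 2)%:E).
  apply/integrableP; split; first by apply/measurable_EFinP;
    exact: measurable_funX.
  by under eq_integral do rewrite gee0_abs ?lee_fin ?sqr_ge0//.
rewrite /variance !unlock /=; set c := fine _.
have Ec : (\int[P]_w (X w)%:E = c%:E)%E by rewrite fineK// integrable_fin_num.
have ic : P.-integrable setT (EFin \o cst (c ^+ 2)).
  by apply: (@bounded_prob_integrable _ _ _ P _ `|c ^+ 2|).
have iz := integrableZl measurableT (2 * c) i1.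
rewrite (_ : (\int[P]_w _)%E = \int[P]_w ((X w ^+ 2)%:E - (2 * c)%:E * (X w)%:E
  + (cst (c ^+ 2) w)%:E))%E; last first.
  apply: eq_integral => w _; rewrite -[LHS]/(((X w - c) * (X w - c))%:E).
  by rewrite -EFinM -EFinB -EFinD; congr EFin; rewrite /cst; ring.
rewrite integralD//; last exact: integrableB.
rewrite integralB// integralZl// (integral_prob_cst P (c ^+ 2)%:E) Ec.
have : (\int[P]_w (X w ^+ 2)%:E)%E \is a fin_num by rewrite integrable_fin_num.
case: (\int[P]_w (X w ^+ 2)%:E)%E => // r _.
by rewrite -EFinM -!EFinB -EFinD; congr EFin; ring.
Qed.

End moments.

(** When both variables have all moments, the smooth noise serves. Otherwise [heavy_law] does, and
    the claim on its moments is vacuous. *)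
Lemma exists_loss_dominated d (T : measurableType d) (R : realType)
    (P : probability T R) (X Y : {RV P >-> R}) :
  (\int[P]_w (X w ^+ 2)%:E < \int[P]_w (Y w ^+ 2)%:E < +oo)%E ->
  ('E_P[X] = 'E_P[Y])%E ->
  exists2 nu, loss_dominated (distribution P X) (distribution P Y) nu &
    finite_moments P X -> finite_moments P Y ->
    forall n, (\int[nu]_x (`|x| ^+ n)%:E < +oo)%E.
Proof.
move=> /andP[XY Y2] eqE.
have mX n : measurable_fun setT (fun x : R => (`|x| ^+ n)%:E).
  by apply/measurable_EFinP; exact: measurable_funX.
have m2 : measurable_fun setT (fun x : R => (x ^+ 2)%:E).
  by apply/measurable_EFinP; exact: measurable_funX.
have iX := integrable_of_sqr (lt_trans XY Y2).
have iY := integrable_of_sqr Y2.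
have i1 (V : {RV P >-> R}) : P.-integrable setT (EFin \o V) ->
    (distribution P V).-integrable setT EFin.
  by move=> iV; apply: integrable_pushforward.
have [[fX fY]|nf] := pselect (finite_moments P X /\ finite_moments P Y);
  last first.
  exists (heavy_law R); last by move=> fX fY; exfalso; exact: nf.
  by apply: loss_dominated_heavy; exact: i1.
have mom (V : {RV P >-> R}) : finite_moments P V ->
    forall n, (\int[distribution P V]_x (`|x| ^+ n)%:E < +oo)%E.
  move=> fV n; rewrite ge0_integral_distribution//.
  by have := fV n; rewrite unlock.
have mean : (\int[distribution P X]_x x%:E = \int[distribution P Y]_x x%:E)%E.
  by rewrite !integral_distribution//; move: eqE; rewrite !unlock.
have var : (\int[distribution P X]_x (x ^+ 2)%:E < \int[distribution P Y]_x (x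
  ^+ 2)%:E)%E.
  have p2 (x : R) : (0 <= (x ^+ 2)%:E)%E by rewrite lee_fin sqr_ge0.
  by rewrite !(ge0_integral_distribution _ m2 p2).
have [nu dom fin] := exists_loss_dominated_moments (mom _ fX) (mom _ fY) mean
  var.
by exists nu.
Qed.

(** [Z] is independent of the pair, whereas [Z'] is asked to be independent of [X] and of [Y]
    separately and may live on a further enlargement, which leaves room for the additional noise. *)
Theorem theorem2 (R : realType) (d : measure_display) (T : measurableType d)
    (P : probability T R) (X Y : {RV P >-> R})
    (finX : ('V_P[X] < +oo)%E) (finY : ('V_P[Y] < +oo)%E)
    (eqE : ('E_P[X] = 'E_P[Y])%E) (ltV : ('V_P[X] < 'V_P[Y])%E) :
  exists (d1 : measure_display) (T1 : measurableType d1)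
    (P1 : probability T1 R) (p : {mfun T1 >-> T}) (Z : {RV P1 >-> R}),
    [/\ enlargement P P1 p,
        independent P1 Z (fun w => (X (p w), Y (p w))),
        ssd_gt P1 ((X \o p) \+ Z) ((Y \o p) \+ Z),
        (forall (d2 : measure_display) (T2 : measurableType d2)
            (P2 : probability T2 R) (q : {mfun T2 >-> T1})
            (Z' : {RV P2 >-> R}),
          enlargement P1 P2 q ->
          independent P2 Z' (X \o p \o q) ->
          independent P2 Z' (Y \o p \o q) ->
          noisier P2 Z' (Z \o q) ->
          ssd_gt P2 ((X \o p \o q) \+ Z') ((Y \o p \o q) \+ Z')) &
        (finite_moments P X -> finite_moments P Y -> finite_moments P1 Z)].
Proof.
have X2 := finite_variance_sqr finX; have Y2 := finite_variance_sqr finY.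
have XY2 : (\int[P]_w (X w ^+ 2)%:E < \int[P]_w (Y w ^+ 2)%:E < +oo)%E.
  (* The squared means are equal and finite, so they cancel. *)
  rewrite Y2 andbT; move: ltV; rewrite !variance_sqr// eqE.
  by rewrite lteD2rE.
have [nu dom fin] := exists_loss_dominated XY2 eqE.
have XY2' : (\int[distribution P X]_x (x ^+ 2)%:E <
             \int[distribution P Y]_x (x ^+ 2)%:E < +oo)%E.
  have m2 : measurable_fun setT (fun x : R => (x ^+ 2)%:E).
    by apply/measurable_EFinP; exact: measurable_funX.
  have p2 (x : R) : (0 <= (x ^+ 2)%:E)%E by rewrite lee_fin sqr_ge0.
  by rewrite !(ge0_integral_distribution _ m2 p2).
(* The enlargement is the product with a line of law [nu], on which [Z] is the second projection. *)
pose P1 : probability (T * R)%type R := (P \x nu)%E.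
pose p : {mfun (T * R)%type >-> T} :=
  HB.pack (@fst T R) (isMeasurableFun.Build _ _ _ _ (@fst T R) measurable_fst).
pose Z : {RV P1 >-> R} :=
  HB.pack (@snd T R) (isMeasurableFun.Build _ _ _ _ (@snd T R) measurable_snd).
have P1E A B : measurable A -> measurable B -> P1 (A `*` B) = (P A * nu B)%E.
  by move=> mA mB; exact: product_measure1E.
have pP A : measurable A -> P1 (p @^-1` A) = P A.
  move=> mA; rewrite (_ : _ @^-1` _ = A `*` setT); last first.
    by apply/seteqP; split=> -[x y] //= [].
  by rewrite P1E//= probability_setT mule1.
have Znu A : measurable A -> P1 (Z @^-1` A) = nu A.
  move=> mA; rewrite (_ : _ @^-1` _ = setT `*` A); last first.
    by apply/seteqP; split=> -[x y] //= [].
  by rewrite P1E//= probability_setT mul1e.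
have indep d' (T' : measurableType d') (V : {mfun T >->
  T'}) : independent P1 Z (V \o p).
  move=> A B mA mB.
  have mVB : measurable (V @^-1` B) by rewrite -[_ @^-1` _]setTI;
    exact: measurable_funP.
  rewrite Znu// [(V \o p) @^-1` B]comp_preimage pP// muleC -P1E//.
  by congr (P1 _); apply/seteqP; split=> -[x y] /= [].
have law (V : {RV P >-> R}) A : measurable A ->
    P1 ((V \o p) @^-1` A) = distribution P V A.
  by move=> mA; apply: pP; rewrite -[_ @^-1` _]setTI; exact: measurable_funP.
exists _, (T * R)%type, P1, p, Z; split => //.
- exact: (indep _ _ (mfun_pair X Y)).
(* With [W = 0], the claim for [Z] is an instance of the one for noisier variables. *)
- have noisyZ : noisier P1 Z Z.
    exists (cst 0); split; last by apply/funext => w; rewrite /= addr0.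
    move=> A B mA mB; rewrite preimage_cst; case: ifP => _.
      by rewrite setTI (@probability_setT _ _ _ P1) mul1e.
    by rewrite set0I measure0 mul0e.
  exact: (ssd_gt_noise (law X) (law Y) Znu (indep _ _ X) (indep _ _ Y) noisyZ
    dom XY2').
- move=> d2 T2 P2 q Z' qP Z'X Z'Y Z'Z.
  have lawq (V : {mfun (T * R)%type >-> R}) (c : probability R R) :
      (forall A, measurable A -> P1 (V @^-1` A) = c A) ->
      forall A, measurable A -> P2 ((V \o q) @^-1` A) = c A.
    move=> Vc A mA; apply: etrans (Vc A mA); apply: qP.
    by rewrite -[_ @^-1` _]setTI; exact: measurable_funP.
  exact: (ssd_gt_noise (X := X \o p \o q) (Y := Y \o p \o q) (lawq _ _ (law X))
    (lawq _ _ (law Y)) (lawq _ _ Znu) Z'X Z'Y Z'Z dom XY2').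
- move=> fX fY n; rewrite unlock.
  rewrite (same_law_ge0_integral (f := fun x => (`|x| ^+ n)%:E) Znu)//.
  + exact: fin.
  + by apply/measurable_EFinP; exact: measurable_funX.
Qed.
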